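(* Let $X$ be a Banach space, and suppose that there exists a bounded, linear surjection $T\colon C_0[0,\omega_1)\to X$. Then exactly one of the following two alternatives holds: (I) $X$ embeds in a Hilbert-generated Banach space; or (II) the identity operator on $C_0[0,\omega_1)$ factors through $T$, and $X$ is isomorphic to the direct sum of $C_0[0,\omega_1)$ and a subspace of a Hilbert-generated Banach space.
   Context: Banach spaces are over $\mathbb{K}=\mathbb{R}$ or $\mathbb{K}=\mathbb{C}$. $\omega_1$ is the first uncountable ordinal; ordinal intervals carry the order topology. $C_0[0,\omega_1)$ is the Banach space (supremum norm) of continuous functions $f\colon[0,\omega_1)\to\mathbb{K}$ that vanish eventually. Isomorphic means linearly homeomorphic; ''$X$ embeds in $Y$'' means that $X$ is isomorphic to a closed subspace of $Y$; subspaces, regarded as Banach spaces, are closed. A Banach space $Y$ is Hilbert-generated if there exists a bounded operator from a Hilbert space onto a dense subspace of $Y$. An operator $S\colon W\to X$ factors through an operator $T\colon Y\to Z$ if $S=UTR$ for some bounded operators $R\colon W\to Y$ and $U\colon Z\to X$. *)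

(* Defs.v *)
From HB Require Import structures.
From mathcomp Require Import all_boot all_order all_algebra.
From mathcomp Require Import all_classical all_reals all_analysis.
From mathcomp Require Import wochoice complex sesquilinear.

Set Implicit Arguments.
Unset Strict Implicit.
Unset Printing Implicit Defensive.

Import Order.TTheory GRing.Theory Num.Theory.
Import numFieldNormedType.Exports.

Local Open Scope classical_set_scope.
Local Open Scope ring_scope.

Definition wo_le : rel (nat -> bool) := sval (well_ordering_principle (nat -> bool : eqType)).

Lemma wo_leP : well_order wo_le.
Proof. exact: (svalP (well_ordering_principle (nat -> bool : eqType))). Qed.

Lemma wo_le_min (A : set (nat -> bool)) : A !=set0 ->
  exists2 z, A z & forall x, A x -> wo_le z x.
Proof.
move=> [x Ax].
have [|z [[Az zA] _]] := wo_leP (A := [pred x | x \in A]).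
  by exists x; exact: (mem_set Ax).
exists z; first exact: (set_mem Az).
by move=> y Ay; apply: zA; exact: (mem_set Ay).
Qed.

Lemma wo_le_refl : reflexive wo_le.
Proof. by move=> x; have [|_ -> h] := @wo_le_min [set x]; [exists x|exact: h]. Qed.

Lemma wo_le_total : total wo_le.
Proof.
move=> x y; have [|z zxy h] := @wo_le_min [set x; y]; first by exists x; left.
have := (h x (or_introl erefl), h y (or_intror erefl)).
by case: zxy => -> [hx hy]; rewrite ?hx ?hy ?orbT.
Qed.

Lemma wo_le_anti : antisymmetric wo_le.
Proof.
move=> x y /andP[xy yx].
have [|z [_ uniq]] := wo_leP (A := pred2 x y).
  by exists x; rewrite inE eqxx.
have minx : minimum_of wo_le (pred2 x y) x.
  split; first by rewrite inE eqxx.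
  by move=> t; rewrite inE => /orP[]/eqP->//; exact: wo_le_refl.
have miny : minimum_of wo_le (pred2 x y) y.
  split; first by rewrite inE eqxx orbT.
  by move=> t; rewrite inE => /orP[]/eqP->//; exact: wo_le_refl.
by rewrite -(uniq _ minx) (uniq _ miny).
Qed.

Lemma wo_le_trans : transitive wo_le.
Proof.
move=> y x z xy yz.
have [|t txyz h] := @wo_le_min [set x; y; z].
  by exists x; left; left.
have tx : wo_le t x by apply: h; left; left.
have ty : wo_le t y by apply: h; left; right.
have tz : wo_le t z by apply: h; right.
case: txyz => [[]|] tE; rewrite {}tE in tx ty tz; first exact: tz.
- by have -> : x = y by apply: wo_le_anti; rewrite xy tx.
- by have <- : y = z by apply: wo_le_anti; rewrite yz ty.
Qed.

(* A concrete copy of [0, omega_1): the elements of a well-ordered copy of the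
   continuum that have only countably many predecessors.  The lemmas
   omega1_well_founded, omega1_countable_segment and omega1_uncountable
   characterise it up to order isomorphism. *)
Record omega1 := Omega1 {
  omega1_val : nat -> bool;
  omega1_valP : omega1_val \in
    [pred x | `[< countable [set y | wo_le y x] >]] }.

HB.instance Definition _ := [isSub for omega1_val].
HB.instance Definition _ := [Choice of omega1 by <:].

Definition omega1_le : rel omega1 :=
  fun x y => wo_le (omega1_val x) (omega1_val y).

Lemma omega1_le_refl : reflexive omega1_le.
Proof. by move=> x; exact: wo_le_refl. Qed.
Lemma omega1_le_anti : antisymmetric omega1_le.
Proof. by move=> x y /wo_le_anti/val_inj. Qed.
Lemma omega1_le_trans : transitive omega1_le.
Proof. by move=> y x z; exact: wo_le_trans. Qed.
Lemma omega1_le_total : total omega1_le.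
Proof. by move=> x y; exact: wo_le_total. Qed.

Fact omega1_display : Order.disp_t. Proof. exact: Order.Disp tt tt. Qed.

HB.instance Definition _ := Order.Le_isPOrder.Build omega1_display omega1
  omega1_le_refl omega1_le_anti omega1_le_trans.
HB.instance Definition _ := Order.POrder_isTotal.Build omega1_display omega1
  omega1_le_total.
HB.instance Definition _ := OrderTopological.copy omega1 (order_topology omega1).

Lemma omega1_leE (x y : omega1) : (x <= y)%O = wo_le (val x) (val y).
Proof. by []. Qed.

Lemma omega1_well_founded (A : set omega1) : A !=set0 ->
  exists2 z, A z & forall x, A x -> (z <= x)%O.
Proof.
move=> [a Aa].
have [|_ [z Az <-] h] := @wo_le_min [set val x | x in A]; first by exists (val a), a.
by exists z => // x Ax; apply: h; exists x.
Qed.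

Lemma omega1_countable_segment (x : omega1) :
  countable [set y : omega1 | (y < x)%O].
Proof.
have /asboolP/countable_injP[f finj] := omega1_valP x.
apply/countable_injP; exists (f \o val) => y z /set_mem/= yx /set_mem/= zx fyz.
by apply/val_inj/finj => //; rewrite inE; [move/ltW: yx|move/ltW: zx].
Qed.

Lemma omega1_uncountable : ~ countable [set: omega1].
Proof.
move=> /countable_injP[f finj].
have cU : countable [set x : nat -> bool | countable [set y | wo_le y x]].
  apply/countable_injP.
  exists (fun x => if pselect (countable [set y | wo_le y x]) is left h
     then f (Omega1 (introT (asboolP _) h)) else 0%N).
  move=> x y /set_mem/= cx /set_mem/= cy.
  case: pselect => // hx; case: pselect => // hy /finj.
  by rewrite !in_setT => /(_ erefl erefl)[].
have [nall|] := pselect (exists x, ~ countable [set y | wo_le y x]).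
  have [x ncx minx] := wo_le_min (A := [set x | ~ countable [set y | wo_le y x]]) nall.
  apply: ncx.
  have : countable (\bigcup_(i in [set: bool]) (if i then [set x]
     else [set x : nat -> bool | countable [set y | wo_le y x]])).
    by apply: bigcup_countable => // -[].
  apply: sub_countable; apply: subset_card_le => y /= yx.
  have [->|nyx] := pselect (y = x); [by exists true|exists false => //=].
  apply: contrapT => /minx xy; apply: nyx; apply: wo_le_anti.
  by rewrite yx xy.
move/forallNP => all.
have /countable_injP[g ginj] : countable [set: nat -> bool].
  by apply: sub_countable cU; apply: subset_card_le => x _; exact: contrapT (all x).
pose d n := ~~ `[< exists2 x, g x = n & x n >].
have : d (g d) = ~~ d (g d).
  rewrite {1}/d; congr negb; apply/asboolP/idP => [[x /ginj]|h]; last by exists d.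
  by rewrite !in_setT => /(_ erefl erefl) ->.
by case: (d _).
Qed.

Lemma omega1_0 : inhabited omega1.
Proof.
apply: contrapT => h; apply: omega1_uncountable.
by apply/countable_injP; exists (fun=> 0%N) => x; case: h.
Qed.

Lemma omega1_countable_bounded (a : nat -> omega1) :
  exists b, forall n, (a n <= b)%O.
Proof.
apply: contrapT => /forallNP h; apply: omega1_uncountable.
apply: sub_countable (bigcup_countable (D := [set: nat])
  (F := fun n => [set y | (y < a n)%O]) _ _) => //.
  apply: subset_card_le => y _.
  by have /existsNP[n /negP] := h y; rewrite -ltNge => yn; exists n.
by move=> n _; exact: omega1_countable_segment.
Qed.

(* The scalar field is either R or C = R[i], as a numFieldType; norms are
   K-valued, so for K = R[i] they are the (real) nonnegative elements of K. *)
Variant scalar_kind := real_scalars | complex_scalars.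

Definition scalar_field (R : realType) (k : scalar_kind) : numFieldType :=
  if k is real_scalars then R else R[i].

Definition scalar_conj (R : realType) (k : scalar_kind) :
    scalar_field R k -> scalar_field R k :=
  match k with
  | real_scalars => fun x : R => x
  | complex_scalars => fun z : R[i] => (z^* )%C
  end.

Lemma scalar_conj_is_zmod_morphism (R : realType) (k : scalar_kind) :
  zmod_morphism (@scalar_conj R k).
Proof. by case: k => //= x y; exact: raddfB. Qed.

Lemma scalar_conj_is_monoid_morphism (R : realType) (k : scalar_kind) :
  monoid_morphism (@scalar_conj R k).
Proof.
by case: k => //=; split; [exact: rmorph1|move=> x y; exact: rmorphM].
Qed.

HB.instance Definition _ (R : realType) (k : scalar_kind) :=
  GRing.isZmodMorphism.Build (scalar_field R k) (scalar_field R k)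
    (@scalar_conj R k) (@scalar_conj_is_zmod_morphism R k).
HB.instance Definition _ (R : realType) (k : scalar_kind) :=
  GRing.isMonoidMorphism.Build (scalar_field R k) (scalar_field R k)
    (@scalar_conj R k) (@scalar_conj_is_monoid_morphism R k).

Lemma scalar_conjK (R : realType) (k : scalar_kind) :
  involutive (@scalar_conj R k).
Proof. by case: k => //= x; exact: conjcK. Qed.

Lemma scalar_mul_conj (R : realType) (k : scalar_kind) (x : scalar_field R k) :
  x * scalar_conj x = `|x| ^+ 2.
Proof.
case: k x => x; first by rewrite real_normK ?num_real.
by rewrite (normCK (x : R[i])).
Qed.

Section scalar_facts.
Variable R : realType.

Lemma normc_ge_Im' (z : R[i]) : `|complex.Im z|%:C%C <= `|z|.
Proof.
rewrite normc_def lecR -sqrtr_sqr ler_wsqrtr// lerDr sqr_ge0 //.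
Qed.

Lemma normc_le_ReIm (z : R[i]) :
  `|z| <= (`|complex.Re z| + `|complex.Im z|)%:C%C.
Proof.
rewrite normc_def lecR -[leRHS]ger0_norm ?addr_ge0// -sqrtr_sqr ler_wsqrtr//.
by rewrite sqrrD !real_normK ?num_real// lerD2r lerDl mulrn_wge0 ?mulr_ge0.
Qed.

Lemma complex_complete (F : set_system (scalar_field R complex_scalars)) :
  ProperFilter F -> cauchy F -> cvg F.
Proof.
move=> FF /cauchy_ballP Fc.
have part (p : R[i] -> R) (pB : forall x y, p (x - y) = p x - p y)
    (ple : forall z, `|p z|%:C%C <= `|z|) : cvg (p @ F).
  apply: cauchy_cvg; apply/cauchy_ballP => e e0.
  have := Fc e%:C%C; rewrite ltcR => /(_ e0) [[A B] /= [FA FB] AB].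
  exists (p @` A, p @` B) => /=.
    by split; [apply: filterS FA|apply: filterS FB] => z Hz; exists z.
  move=> [_ _] /= [[x Ax <-] [y By <-]].
  have := AB (x, y) (conj Ax By).
  rewrite -!ball_normE /= => /(le_lt_trans (ple _)).
  by rewrite ltcR pB.
have /cvg_ex[/= a Fa] := part (@complex.Re R) (fun x y => raddfB _ x y) (@normc_ge_Re R).
have /cvg_ex[/= b Fb] := part (@complex.Im R) (fun x y => raddfB _ x y) normc_ge_Im'.
refine (proj2 (@cvg_ex _ F) _); exists ((a +i* b)%C : scalar_field R complex_scalars).
apply/cvgrPdist_lt => e e0.
have [e1 ee1] : exists e1, e = e1%:C%C.
  exists (complex.Re e); case: e e0 => u v; rewrite ltcE /= => /andP[/eqP -> _] //.
rewrite {}ee1 ltcR in e0 *.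
have e20 : 0 < e1 / 2 by rewrite divr_gt0.
near=> z.
apply: le_lt_trans (normc_le_ReIm _) _.
rewrite ltcR (splitr e1) !raddfB /= ltrD//; near: z.
  by move/cvgrPdist_lt : Fa; exact.
by move/cvgrPdist_lt : Fb; exact.
Unshelve. all: by end_near. Qed.

Lemma scalar_complete (k : scalar_kind) (F : set_system (scalar_field R k)) :
  ProperFilter F -> cauchy F -> cvg F.
Proof.
case: k F => F; first exact: R_complete.
exact: complex_complete.
Qed.

Lemma scalar_supremums (k : scalar_kind) (A : set (scalar_field R k)) :
  A !=set0 -> (forall x, A x -> 0 <= x) -> ubound A !=set0 ->
  supremums A !=set0.
Proof.
case: k A => A A0 Age0 [M uM].
  exists (sup A); split; first by apply: ub_le_sup; exists M.
  by move=> B uB; exact: ge_sup.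
have im0 (z : R[i]) : 0 <= z -> z = (complex.Re z)%:C%C.
  by case: z => u v; rewrite lecE /= => /andP[/eqP -> _].
have ReA B : ubound A B -> forall x, A x -> complex.Re x <= complex.Re B.
  by move=> uB x /uB; rewrite lecE => /andP[_ ].
have suA : has_sup (@complex.Re R @` A).
  split; first by move: A0 => [x Ax]; exists (complex.Re x), x.
  by exists (complex.Re M) => _ [x Ax <-]; exact: ReA.
exists (sup (@complex.Re R @` A))%:C%C; split.
  move=> x Ax; rewrite (im0 x (Age0 x Ax)) lecR.
  by apply: ub_le_sup; [case: suA|exists x].
move=> B uB.
have B0 : 0 <= B by move: A0 => [x Ax]; exact: le_trans (Age0 x Ax) (uB x Ax).
rewrite (im0 B B0) lecR; apply: ge_sup; first by case: suA.
by move=> _ [x Ax <-]; exact: ReA.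
Qed.

Lemma scalar_archi (k : scalar_kind) (e : scalar_field R k) :
  0 < e -> exists n : nat, n.+1%:R^-1 < e.
Proof.
have Rarchi (r : R) : 0 < r -> exists n : nat, n.+1%:R^-1 < r.
  move=> r0; exists (Num.trunc r^-1).
  by rewrite invf_plt ?posrE// truncnS_gt.
case: k e => e; first exact: Rarchi.
case: e => u v; rewrite ltcE /= => /andP[/eqP -> /Rarchi[n nu]].
exists n; rewrite [X in _ < X](_ : _ = u%:C%C)//.
have -> : n.+1%:R^-1 = (n.+1%:R^-1)%:C%C :> R[i] by rewrite fmorphV rmorph_nat.
by rewrite ltcR.
Qed.

End scalar_facts.

Section C0_omega1.
Variables (R : realType) (k : scalar_kind).
Local Notation K := (scalar_field R k).

Definition C0_pred : {pred omega1 -> K} := [pred f : omega1 -> K |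
  `[< continuous f /\ exists a, forall b, (a <= b)%O -> f b = 0 >]].

Record C0_omega1 := C0Omega1 {
  C0_fun :> omega1 -> K ; C0_funP : C0_fun \in C0_pred }.

HB.instance Definition _ := [isSub for C0_fun].
HB.instance Definition _ := [Choice of C0_omega1 by <:].

Lemma C0_submod_closed : submod_closed C0_pred.
Proof.
split.
  by apply/asboolP; split; [exact: cst_continuous|case: omega1_0 => a; exists a].
move=> c f g /asboolP[fc [a fa]] /asboolP[gc [b gb]]; apply/asboolP; split.
  by move=> x; exact: (cvgD (cvgZr (fc x)) (gc x)).
exists (Order.max a b) => x; rewrite ge_max => /andP[ax bx].
by rewrite /= !fctE /= fa// gb// scaler0 addr0.
Qed.
HB.instance Definition _ :=
  GRing.isSubmodClosed.Build K (omega1 -> K) C0_pred C0_submod_closed.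
HB.instance Definition _ := [SubChoice_isSubLmodule of C0_omega1 by <:].

Lemma C0_continuous (f : C0_omega1) : continuous f.
Proof. by have /asboolP[] := C0_funP f. Qed.

Lemma C0_eventually0 (f : C0_omega1) :
  exists a, forall b, (a <= b)%O -> f b = 0.
Proof. by have /asboolP[] := C0_funP f. Qed.

Lemma C0_bounded (f : C0_omega1) : exists M : K, forall x, `|f x| <= M.
Proof.
pose bnd a := exists2 M : K, 0 <= M & forall x, (x <= a)%O -> `|f x| <= M.
have [a fa] := C0_eventually0 f.
suff [M M0 fM] : bnd a.
  exists M => x; have [/fM//|/ltW ax] := leP x a.
  by rewrite fa// normr0.
apply: contrapT => nbnd.
have [|{nbnd} c /= na mina] := @omega1_well_founded [set a | ~ bnd a].
  by exists a.
move: c na mina => {a fa} a na mina; apply: na.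
have bndlt b : (b < a)%O -> bnd b.
  by move=> ba; apply: contrapT => /mina; rewrite leNgt ba.
have /cvgrPdist_lt /(_ 1 ltr01) := @C0_continuous f a.
rewrite near_simpl -nbhs_nearE itv_nbhsE => -[[l u] /= [lo alu] fl].
have Ha x : (x <= a)%O -> (l <= BLeft x)%O -> `|f x| <= `|f a| + 1.
  move=> xa lx; have : `|f a - f x| < 1.
    apply: fl; rewrite /= itv_boundlr lx /=.
    move: alu; rewrite itv_boundlr => /andP[_]; apply: le_trans.
    by rewrite bnd_simp.
  move=> /ltW; rewrite distrC => h.
  by rewrite -[f x](subrK (f a)) (le_trans (ler_normD _ _))// addrC lerD2l.
have fa1 : 0 <= `|f a| + 1 by rewrite addr_ge0.
case: l alu fl Ha lo => [[] l|[]] alu fl Ha lo.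
- by move/itv_open_ends_lside : lo.
- have [M M0 fM] : bnd l.
    by apply: bndlt; move: alu; rewrite itv_boundlr bnd_simp => /andP[].
  exists (M + (`|f a| + 1)) => [|x xa]; first exact: addr_ge0.
  have [xl|lx] := leP x l.
    by rewrite (le_trans (fM x xl))// lerDl.
  by rewrite (le_trans (Ha x xa _))// lerDr.
- by exists (`|f a| + 1) => // x xa; exact: Ha.
- by move: alu; rewrite itv_boundlr.
Qed.

Definition C0_norm (f : C0_omega1) : K :=
  supremum 0 [set `|f x| | x in [set: omega1]].

Lemma C0_norm_sup (f : C0_omega1) :
  supremums [set `|f x| | x in [set: omega1]] (C0_norm f).
Proof.
have [x0] := omega1_0.
have A0 : [set `|f x| | x in [set: omega1]] !=set0 by exists `|f x0|, x0.
have [M fM] := C0_bounded f.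
have [] := @scalar_supremums R k [set `|f x| | x in [set: omega1]] A0.
- by move=> _ [x _ <-].
- by exists M => _ [x _ <-].
move=> s sA; rewrite /C0_norm /supremum ifF; last by apply/negbTE/set0P.
exact: xgetI sA.
Qed.

Lemma C0_norm_ge (f : C0_omega1) x : `|f x| <= C0_norm f.
Proof. by have [+ _] := C0_norm_sup f; apply; exists x. Qed.

Lemma C0_norm_le (f : C0_omega1) M :
  (forall x, `|f x| <= M) -> C0_norm f <= M.
Proof. by move=> fM; have [_] := C0_norm_sup f; apply => _ [x _ <-]. Qed.

Lemma C0_norm_ge0 f : 0 <= C0_norm f.
Proof. by have [x] := omega1_0; exact: le_trans (C0_norm_ge f x). Qed.

Lemma C0_normD f g : C0_norm (f + g) <= C0_norm f + C0_norm g.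
Proof.
apply: C0_norm_le => x; apply: le_trans (ler_normD (f x) (g x)) _.
by apply: lerD; exact: C0_norm_ge.
Qed.

Lemma C0_normZ (l : K) f : C0_norm (l *: f) = `|l| * C0_norm f.
Proof.
apply/eqP; rewrite eq_le; apply/andP; split.
  by apply: C0_norm_le => x; rewrite normrZ ler_wpM2l// C0_norm_ge.
have [->|l0] := eqVneq l 0; first by rewrite normr0 mul0r C0_norm_ge0.
rewrite mulrC -ler_pdivlMr ?normr_gt0//; apply: C0_norm_le => x.
rewrite ler_pdivlMr ?normr_gt0// mulrC -normrZ.
exact: (C0_norm_ge (l *: f) x).
Qed.

Lemma C0_norm_eq0 f : C0_norm f = 0 -> f = 0.
Proof.
move=> f0; apply/val_inj/funext => x; apply/eqP.
by rewrite -normr_le0 -f0; exact: C0_norm_ge.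
Qed.

HB.instance Definition _ := Lmodule_isNormed.Build K C0_omega1
  C0_normD C0_normZ C0_norm_eq0.
HB.instance Definition _ := isPointed.Build C0_omega1 0.

Lemma C0_normE (f : C0_omega1) :
  `|f| = supremum 0 [set `|f x| | x in [set: omega1]].
Proof. by []. Qed.

Lemma C0_complete (F : set_system C0_omega1) :
  ProperFilter F -> cauchy F -> cvg F.
Proof.
move=> FF /cauchy_ballP Fc.
have cvgx x : cvg ((fun f : C0_omega1 => f x) @ F).
  apply: scalar_complete; apply/cauchy_ballP => e /Fc [[A B] /= [FA FB] AB].
  exists ((fun f : C0_omega1 => f x) @` A, (fun f : C0_omega1 => f x) @` B) => /=.
    by split; [apply: filterS FA|apply: filterS FB] => z Hz; exists z.
  move=> [_ _] /= [[u Au <-] [v Bv <-]].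
  have := AB (u, v) (conj Au Bv); rewrite -!ball_normE /=.
  exact: le_lt_trans (C0_norm_ge (u - v) x).
pose g x : K := lim ((fun f : C0_omega1 => f x) @ F).
have Fg e : 0 < e -> F [set f : C0_omega1 | forall x, `|g x - f x| <= e].
  move=> e0; have e20 : 0 < e / 2 by rewrite divr_gt0.
  have [[A B] /= [FA FB] AB] := Fc _ e20.
  apply: filterS FA => f Af x.
  have [h [Bh]] : exists h, B h /\ `|g x - h x| < e / 2.
    have /cvgrPdist_lt/(_ _ e20) gx : (fun f : C0_omega1 => f x) @ F --> g x.
      exact: cvgx.
    have [h [Bh hx]] := filter_ex (filterI FB gx).
    by exists h.
  move=> /ltW ghx; rewrite -(subrK (h x) (g x)) -addrA (splitr e).
  apply: le_trans (ler_normD _ _) _; apply: lerD => //.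
  have := AB (f, h) (conj Af Bh); rewrite -!ball_normE /= distrC => /ltW.
  exact: le_trans (C0_norm_ge (h - f) x).
have gcont : continuous g.
  - move=> x; apply/(@cvgrPdist_lt _ _ _ (nbhs x) (nbhs_filter x)) => e e0.
    have e30 : 0 < e / 3 by rewrite divr_gt0.
    have [f fg] := filter_ex (Fg _ e30).
    have /cvgrPdist_lt/(_ _ e30) := @C0_continuous f x.
    apply: (@filterS _ _ (nbhs_filter x)) => y fxy.
    have -> : g x - g y = (g x - f x) + ((f x - f y) + (f y - g y)).
      by rewrite !addrA !subrK.
    have -> : e = e / 3 + (e / 3 + e / 3).
      by rewrite -!mulrDl (_ : e + (e + e) = e * 3%:R) ?mulfK ?pnatr_eq0// mulr_natr.
    apply: le_lt_trans (ler_normD _ _) _; apply: ler_ltD; first exact: fg.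
    apply: le_lt_trans (ler_normD _ _) _; apply: ltr_leD => //.
    by rewrite distrC; exact: fg.
have gC : g \in C0_pred.
  apply/asboolP; split=> //.
  have /choice[h hP] n : exists f : C0_omega1, forall x, `|g x - f x| <= n.+1%:R^-1.
    by apply: filter_ex (Fg _ _); rewrite invr_gt0.
  have /choice[a aP] n := C0_eventually0 (h n).
  have [b ab] := omega1_countable_bounded a.
  exists b => x bx; apply: contrapT => /eqP; rewrite -normr_gt0 => gx0.
  have gn n : `|g x| <= n.+1%:R^-1.
    by have := hP n x; rewrite aP ?subr0// (le_trans (ab n)).
  have [n gxn] := scalar_archi gx0.
  by have := lt_le_trans gxn (gn n); rewrite ltxx.
refine (proj2 (@cvg_ex _ F) _); exists (C0Omega1 gC).
apply/cvgrPdist_le => e e0; apply: filterS (Fg _ e0) => f fg.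
exact: C0_norm_le.
Qed.
HB.instance Definition _ := Uniform_isComplete.Build C0_omega1 C0_complete.
End C0_omega1.

Record closed_subspace (K : numFieldType) (Y : normedModType K) :=
  ClosedSubspace {
    csub_set :> set Y ;
    csub_closed : closed csub_set ;
    csub0 : csub_set 0 ;
    csubP : forall (a : K) u v,
      csub_set u -> csub_set v -> csub_set (a *: u + v) }.

Section subspace_type.
Context (K : numFieldType) (Y : normedModType K) (S : closed_subspace Y).

Definition csub_pred : {pred Y} := [pred y | `[< csub_set S y >]].

Record csub_type := CsubType {
  csub_val : Y ; csub_valP : csub_val \in csub_pred }.

HB.instance Definition _ := [isSub for csub_val].
HB.instance Definition _ := [Choice of csub_type by <:].

Lemma csub_submod_closed : submod_closed csub_pred.
Proof.
split; first exact/asboolP/csub0.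
by move=> a u v /asboolP Su /asboolP Sv; exact/asboolP/csubP.
Qed.
HB.instance Definition _ :=
  GRing.isSubmodClosed.Build K Y csub_pred csub_submod_closed.
HB.instance Definition _ := [SubChoice_isSubLmodule of csub_type by <:].

Definition csub_norm (x : csub_type) : K := `|csub_val x|.

Lemma csub_normD x y : csub_norm (x + y) <= csub_norm x + csub_norm y.
Proof. exact: ler_normD. Qed.
Lemma csub_normZ (l : K) x : csub_norm (l *: x) = `|l| * csub_norm x.
Proof. exact: normrZ. Qed.
Lemma csub_norm_eq0 x : csub_norm x = 0 -> x = 0.
Proof. by move=> /normr0_eq0 x0; exact/val_inj. Qed.

HB.instance Definition _ := Lmodule_isNormed.Build K csub_type
  csub_normD csub_normZ csub_norm_eq0.
HB.instance Definition _ := isPointed.Build csub_type 0.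

End subspace_type.

Section subspace_complete.
Context (K : numFieldType) (Y : completeNormedModType K) (S : closed_subspace Y).

Lemma csub_complete (F : set_system (csub_type S)) :
  ProperFilter F -> cauchy F -> cvg F.
Proof.
move=> FF /cauchy_ballP Fc.
have /cvg_ex[/= y Fy] : cvg (@csub_val _ _ S @ F).
  apply: cauchy_cvg; apply/cauchy_ballP => e /Fc [[A B] /= [FA FB] AB].
  exists (@csub_val _ _ S @` A, @csub_val _ _ S @` B) => /=.
    by split; [apply: filterS FA|apply: filterS FB] => z Hz; exists z.
  move=> [_ _] /= [[u Au <-] [v Bv <-]].
  by have := AB (u, v) (conj Au Bv); rewrite -!ball_normE.
have Sy : csub_set S y.
  apply: (@closed_cvg _ _ F FF (@csub_val _ _ S) _ (@csub_closed _ _ S) _ y Fy).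
  by near=> u; have /asboolP := csub_valP u.
refine (proj2 (@cvg_ex _ F) _); exists (CsubType (introT (asboolP _) Sy)).
apply/cvgrPdist_lt => e e0; move/cvgrPdist_lt : Fy; exact.
Unshelve. all: by end_near. Qed.

HB.instance Definition _ := Uniform_isComplete.Build (csub_type S) csub_complete.
End subspace_complete.

Section operators.
Context (K : numFieldType).

Definition bounded_op (V W : normedModType K) (f : V -> W) :=
  exists M : K, forall x, `|f x| <= M * `|x|.

Definition isomorphic (V W : normedModType K) :=
  exists (f : {linear V -> W}) (g : {linear W -> V}),
    [/\ cancel f g, cancel g f, continuous f & continuous g].

Definition embeds (V W : normedModType K) :=
  exists S : closed_subspace W, isomorphic V (csub_type S).

Definition factors_through (V W Y Z : normedModType K)
    (S : {linear V -> W}) (T : {linear Y -> Z}) :=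
  exists (A : {linear V -> Y}) (U : {linear Z -> W}),
    [/\ bounded_op A, bounded_op U & forall x, S x = U (T (A x))].

End operators.

(* {dot H for theta} is positive definite, linear on the left and
   theta-semilinear on the right. *)
Definition is_hilbert (R : realType) (k : scalar_kind)
    (H : completeNormedModType (scalar_field R k)) :=
  exists dot : {dot H for @scalar_conj R k},
    forall x : H, `|x| ^+ 2 = dot x x.

Definition hilbert_generated (R : realType) (k : scalar_kind)
    (Y : completeNormedModType (scalar_field R k)) :=
  exists (H : completeNormedModType (scalar_field R k)) (f : {linear H -> Y}),
    [/\ is_hilbert H, bounded_op f & dense (range f)].

(* Main.v *)
Require Import Defs.
From HB Require Import structures.
From mathcomp Require Import all_boot all_order all_algebra finmap.
From mathcomp Require Import all_classical all_reals all_analysis.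
From mathcomp.analysis.showcase Require Import summability.
From mathcomp Require Import complex sesquilinear ring.

Set Implicit Arguments.
Unset Strict Implicit.
Unset Printing Implicit Defensive.

Import Order.TTheory GRing.Theory Num.Theory.
Import numFieldNormedType.Exports.

Local Open Scope classical_set_scope.
Local Open Scope ring_scope.

(** Let [N = ker T].  If the common zeros of [N] are unbounded in [0, omega_1),
    they form a club; enumerate it by a normal function [p].  By the open mapping
    theorem [T f |-> f o p] is a bounded operator [U] on [X], composition with the
    left adjoint [block] of [p] is a right inverse of [U o T], and [ker U] is the
    image of [F = {f | f o p = 0}].  The space [F] is a [c_0]-sum of separable
    spaces, one for each interval between consecutive points of the club, hence a
    Hilbert space maps onto a dense subspace of it, and so of [ker U].

    If the common zeros are bounded, pressing down yields [g] such that for all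
    [d] and [e > 0] some [f] in [N] satisfies [|f - 1| <= e] on [(g, d]].  Closing
    off under the supports of these [f] gives a club along which [N] approximates
    every indicator of an initial segment: this needs no control of [f] between
    [d] and the next point of the club.  Hence [N + F] is dense for this club,
    [T F] is dense in [X], and [X] is itself Hilbert-generated.

    The alternatives exclude each other because [C_0[0, omega_1)] does not embed
    by [J] in a space [Y] that has a dense image [V H] of a Hilbert space.  Lift
    the functions equal to [1] on [[0, g]] approximately to [H], through [J] and
    [V].  As [g] grows the minimal norms of the lifts stabilise, so by the
    parallelogram law two lifts are close although the functions are at
    distance at least [1]. *)

(** * Normal functions and closed unbounded sets in [0, omega_1) *)

Section omega1_order.
Local Open Scope order_scope.
Implicit Types (x y z : omega1) (A D : set omega1) (p h : omega1 -> omega1).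

Lemma omega1_ind (P : omega1 -> Prop) :
  (forall y, (forall x, x < y -> P x) -> P y) -> forall y, P y.
Proof.
move=> IH y; apply: contrapT => nPy.
have [|z nPz minz] := @omega1_well_founded [set x | ~ P x]; first by exists y.
apply: nPz; apply: IH => x xz; apply: contrapT => /minz.
by rewrite leNgt xz.
Qed.

Lemma omega1_lt_wf : well_founded (fun x y : omega1 => x < y).
Proof. by apply: omega1_ind => y IH; constructor. Qed.

Lemma omega1_countable_le y : countable [set x | x <= y].
Proof.
have /asboolP/countable_injP[f finj] := omega1_valP y.
apply/countable_injP; exists (f \o val) => x z /set_mem/= xy /set_mem/= zy fxz.
by apply/val_inj/finj => //; rewrite inE.
Qed.

Lemma omega1_countable_ub A : countable A -> exists b, forall x, A x -> x <= b.
Proof.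
move=> cA; apply: contrapT => /forallNP h; apply: omega1_uncountable.
apply: sub_countable (bigcup_countable (F := fun a => [set y | y < a]) cA _).
  apply: subset_card_le => y _.
  by have /existsNP[a /not_implyP[Aa /negP]] := h y; rewrite -ltNge => ya; exists a.
by move=> a _; exact: omega1_countable_segment.
Qed.

Lemma omega1_gt y : exists z, y < z.
Proof.
apply: contrapT => /forallNP h; apply: omega1_uncountable.
apply: sub_countable (omega1_countable_le y); apply: subset_card_le => x _ /=.
by rewrite leNgt; apply/negP/h.
Qed.

Lemma omega1_countable_lub A : countable A ->
  exists s, (forall x, A x -> x <= s) /\ forall y, y < s -> exists2 x, A x & y < x.
Proof.
move=> /omega1_countable_ub[b Ab].
have [|s As mins] := @omega1_well_founded [set b | forall x, A x -> x <= b].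
  by exists b.
exists s; split=> // y ys; apply: contrapT => h.
suff /mins : forall x, A x -> x <= y by rewrite leNgt ys.
by move=> x Ax; rewrite leNgt; apply/negP => yx; apply: h; exists x.
Qed.

(** Closing off: each [g x] exceeds [x] and bounds [h] on the countable segment up to [x], so the
    supremum of the iterates of [g] is closed under [h]. *)
Lemma omega1_closure_point h y : exists2 z, y < z & forall x, x < z -> h x < z.
Proof.
have /choice[g gP] x : exists z, x < z /\ forall t, t <= x -> h t <= z.
  have [b hb] : exists b, forall t, (h @` [set t | t <= x]) t -> t <= b.
    apply: omega1_countable_ub; apply: sub_countable (card_image_le _ _) _.
    exact: omega1_countable_le.
  have [c xc] := omega1_gt x; exists (Order.max b c).
  rewrite lt_max xc orbT; split=> // t tx; rewrite le_max hb//.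
have [y' yy'] := omega1_gt y.
pose a n := iter n g y'.
have [|s [as_ sa]] := @omega1_countable_lub (range a).
  by apply: sub_countable (card_image_le _ _) _.
exists s; first by apply: lt_le_trans yy' (as_ _ _); exists 0%N.
move=> x /sa[_ [n _ <-]] xa.
have [_ /(_ _ (ltW xa)) hx] := gP (a n).
(* The iterate [a n.+1] bounds [h x] only weakly; one more iterate makes the inequality strict. *)
have [lt_n2 _] := gP (a n.+1).
by apply: le_lt_trans hx (lt_le_trans lt_n2 _); apply: as_; exists n.+2.
Qed.

(** The segment up to [y] is the open ray below the successor of [y], so only the left side of [y]
    matters. The second alternative covers the least element, which has nothing to its left. *)
Lemma nbhs_omega1P y (W : set omega1) : nbhs y W <->
  (exists2 z, z < y & forall x, z < x <= y -> W x) \/ (forall x, x <= y -> W x).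
Proof.
have open_le : open [set x | x <= y].
  have [b yb minb] := omega1_well_founded (omega1_gt y).
  rewrite (_ : mkset _ = `]-oo, b[%classic); first exact: lray_open.
  apply/seteqP; split => x /=; rewrite in_itv /=.
    by move=> /le_lt_trans; exact.
  by rewrite leNgt => xb; apply/negP => /minb; rewrite leNgt xb.
split=> [|[[z zy zW]|yW]]; last 2 first.
- apply: (@filterS _ (nbhs y) _ (`]z, +oo[%classic `&` [set x | x <= y])).
    by move=> x /=; rewrite in_itv /= andbT => -[? ?]; apply: zW; apply/andP.
  apply: open_nbhs_nbhs; split; last by rewrite /= in_itv /= zy lexx.
  by apply: openI open_le; exact: rray_open.
- apply: (@filterS _ (nbhs y) _ [set x | x <= y]) => //.
  by apply: open_nbhs_nbhs; split => /=.
rewrite itv_nbhsE => -[[l u] /= [lo ylu] luW].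
have uy x : x <= y -> (BLeft x <= u)%O.
  move=> xy; move: ylu; rewrite itv_boundlr => /andP[_]; apply: le_trans.
  by rewrite bnd_simp.
have uy' x : x <= y -> (BRight x <= u)%O.
  move=> xy; move: ylu; rewrite itv_boundlr => /andP[_]; apply: le_trans.
  by rewrite bnd_simp.
case: l lo ylu luW => [[] l|[]] lo ylu luW.
- by move/itv_open_ends_lside : lo.
- left; exists l; first by move: ylu; rewrite itv_boundlr bnd_simp => /andP[].
  move=> x /andP[lx xy]; apply: luW; rewrite /= itv_boundlr bnd_simp lx /=.
  exact: uy'.
- by right=> x xy; apply: luW; rewrite /= itv_boundlr uy'.
- by move: ylu; rewrite itv_boundlr.
Qed.

(** Closedness is stated at all [y] but the least one, where the approximation condition would be
    vacuous. At a successor that condition already forces [y] to be in [D]. *)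
Definition club D := (forall y, exists2 d, D d & y < d) /\
  forall y, (exists x, x < y) ->
    (forall x, x < y -> exists2 d, D d & x < d <= y) -> D y.

Record normal p : Prop := Normal {
  normal_lt : forall x y, x < y -> p x < p y ;
  normal_continuous : continuous p }.

(** Transfinite recursion: [p y] is the least point of [D] above all earlier values. If [p] jumped
    at [y], the supremum of the earlier values would be in [D] by closedness, contradicting the
    minimality of [p y]. *)
Lemma club_enum D : club D -> exists2 p, normal p & forall x, D (p x).
Proof.
move=> [Dunb Dcl].
(* The default [y] is never reached: [D] is unbounded and earlier values are countably many. *)
pose least A y := if pselect (A !=set0) is left h
  then sval (cid2 (omega1_well_founded h)) else y.
have leastP A y : A !=set0 -> A (least A y) /\ forall x, A x -> least A y <= x.
  by rewrite /least => A0; case: pselect => // h; case: cid2.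
pose F y (rec : forall x, x < y -> omega1) :=
  least [set d | D d /\ forall x (xy : x < y), rec x xy < d] y.
pose p := Fix omega1_lt_wf (fun=> omega1) F.
have pE y : p y = least [set d | D d /\ forall x, x < y -> p x < d] y.
  rewrite /p Fix_eq // => x f g fg; congr (F x _).
  by do 2![apply: functional_extensionality_dep => ?]; exact: fg.
have pP y : [/\ D (p y), forall x, x < y -> p x < p y &
    forall d, D d -> (forall x, x < y -> p x < d) -> p y <= d].
  rewrite pE; set A := mkset _; have [|[Dy yA] minA] := leastP A y.
    have [|b pb] := @omega1_countable_ub (p @` [set x | x < y]).
      apply: sub_countable (card_image_le _ _) _.
      exact: omega1_countable_segment.
    have [d Dd bd] := Dunb b; exists d; split=> // x xy.
    by apply: le_lt_trans bd; apply: pb; exists x.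
  by split=> // d Dd dA; exact: minA.
exists p; last by move=> x; case: (pP x).
have plt x y : x < y -> p x < p y by case: (pP y) => _ + _; exact.
have ple x y : x <= y -> p x <= p y.
  by rewrite le_eqVlt => /orP[/eqP->//|/plt/ltW].
split=> // y W /nbhs_omega1P[|Wle]; last first.
  by apply/nbhs_omega1P; right=> x /ple; exact: Wle.
move=> [z zpy zW]; suff : nbhs y [set x | z < p x].
  move=> h; have : nbhs y [set x | x <= y] by apply/nbhs_omega1P; right.
  move=> h2; apply: filterS (filterI h h2) => x [/= zx xy].
  by apply: zW; rewrite zx /= ple.
apply/nbhs_omega1P; apply: contrapT => /not_orP[h1 h2].
have [x0 x0y] : exists2 x0, x0 <= y & p x0 <= z.
  apply: contrapT => h; apply: h2 => x xy; rewrite /= ltNge; apply/negP => xz.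
  by apply: h; exists x.
rewrite le_eqVlt in x0y; move: x0y => /orP[/eqP->|x0y]; first by rewrite leNgt zpy.
move=> _.
(* Discontinuity at [y] means that [p] stays at most [z] cofinally below [y]; in particular [y] is a
   limit. *)
have next x : x < y -> exists2 x', x < x' < y & p x' <= z.
  move=> xy; apply: contrapT => h; apply: h1; exists x => // t /andP[xt].
  rewrite le_eqVlt => /orP[/eqP->//|ty]; rewrite /= ltNge; apply/negP => tz.
  by apply: h; exists t; rewrite ?xt.
have [|s [ps sp]] := @omega1_countable_lub (p @` [set x | x < y]).
  apply: sub_countable (card_image_le _ _) _.
  exact: omega1_countable_segment.
have ps' x : x < y -> p x < s.
  move=> /next[x' /andP[xx' x'y] _]; apply: lt_le_trans (plt _ _ xx') _.
  by apply: ps; exists x'.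
have Ds : D s.
  apply: Dcl; first by exists (p x0); exact: ps'.
  move=> x /sp[_ [x' x'y <-]] xx'; exists (p x'); first by case: (pP x').
  by rewrite xx' ltW// ps'.
have [_ _ /(_ s Ds ps')] := pP y.
apply/negP; rewrite -ltNge; apply: le_lt_trans zpy.
rewrite leNgt; apply/negP => /sp[_ [x' /= x'y <-]] /lt_le_trans.
have [x2 /andP[x'x2 _] x2z] := next _ x'y.
by move=> /(_ _ (ltW (lt_le_trans (plt _ _ x'x2) x2z))); rewrite ltxx.
Qed.

(** * The left adjoint of a normal function *)

Section normal.
Variables (p : omega1 -> omega1) (np : normal p).

Lemma normal_le : {mono p : x y / x <= y}.
Proof. by apply: le_mono => x y; exact: normal_lt. Qed.

Lemma normal_ge x : x <= p x.
Proof.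
elim/omega1_ind: x => x IH; rewrite leNgt; apply/negP => pxx.
by have := IH _ pxx; rewrite leNgt (normal_lt np pxx).
Qed.

(** The fibre over [z] consists of the points after all earlier values of [p], up to and including
    [p z]. The adjunction is [block_le]. *)
Definition block x : omega1 :=
  sval (cid2 (omega1_well_founded (ex_intro (fun y => x <= p y) x (normal_ge x)))).

Lemma block_le x y : (block x <= y) = (x <= p y).
Proof.
rewrite /block; case: cid2 => z /= xpz minz; apply/idP/idP; last exact: minz.
by move=> zy; rewrite (le_trans xpz)// normal_le.
Qed.

Lemma block_lt x y : (y < block x) = (p y < x).
Proof. by rewrite !ltNge block_le. Qed.

Lemma block_normal x : block (p x) = x.
Proof.
apply/eqP; rewrite eq_le block_le lexx /=.
by rewrite -normal_le -block_le.
Qed.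

Lemma block_mono : {homo block : x y / x <= y}.
Proof. by move=> x y xy; rewrite block_le (le_trans xy)// -block_le. Qed.

Lemma block_continuous : continuous block.
Proof.
move=> y W /nbhs_omega1P[[z zy zW]|yW]; apply/nbhs_omega1P; last first.
  by right=> x /block_mono; exact: yW.
left; exists (p z); first by rewrite -block_lt.
by move=> x /andP[zx /block_mono xy]; apply: zW; rewrite block_lt zx.
Qed.

(* A limit block is the single point [p (block y)]: hence an element strictly
   below the end of its block lies in the first block or in a successor one. *)
Lemma block_start y : y < p (block y) ->
  (forall x, x <= y -> block x = block y) \/
  exists2 z, p z < y & forall x, (p z < x <= y) <-> (x <= y /\ block x = block y).
Proof.
have rayP x : (p @^-1` `]y, +oo[%classic) x = (y < p x) :> Prop.
  by rewrite /= in_itv /= andbT.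
move=> yp; have /nbhs_omega1P : nbhs (block y) (p @^-1` `]y, +oo[%classic).
  apply: (normal_continuous np); apply: open_nbhs_nbhs.
  by split; [exact: rray_open|rewrite /= in_itv /= andbT].
move=> [[z zy zb]|h].
  right; exists z; first by rewrite -block_lt.
  move=> x; split=> [/andP[zx xy]|[xy bxy]]; last by rewrite -block_lt bxy zy.
  split=> //; apply/eqP; rewrite eq_le block_mono//= leNgt; apply/negP => bxy.
  have := zb (block x); rewrite block_lt zx (ltW bxy) rayP => /(_ isT)/ltW.
  by rewrite -block_le leNgt bxy.
left=> x xy; apply/eqP; rewrite eq_le block_mono//= leNgt; apply/negP => bxy.
by have := h _ (ltW bxy); rewrite rayP => /ltW; rewrite -block_le leNgt bxy.
Qed.

End normal.
End omega1_order.

(** * Closed subspaces of C_0[0, omega_1) *)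

Section closed_subspaces.
Context (K : numFieldType).

Section subspace.
Context (Y : normedModType K) (S : closed_subspace Y).
Implicit Types (u v x : Y).

Lemma csubD u v : csub_set S u -> csub_set S v -> csub_set S (u + v).
Proof. by move=> Su Sv; rewrite -[u]scale1r; exact: csubP. Qed.

Lemma csubZ a u : csub_set S u -> csub_set S (a *: u).
Proof. by move=> Su; rewrite -[_ *: _]addr0; exact: csubP Su (csub0 S). Qed.

Lemma csubB u v : csub_set S u -> csub_set S v -> csub_set S (u - v).
Proof. by move=> Su Sv; rewrite -scaleN1r addrC; exact: csubP. Qed.

Lemma csub_approx x :
  (forall e, 0 < e -> exists2 v, csub_set S v & `|x - v| <= e) -> csub_set S x.
Proof.
move=> h; apply: csub_closed => W /nbhs_ballP[e /= e0 eW].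
have e20 : 0 < e / 2 by rewrite divr_gt0.
have [v Sv xv] := h _ e20; exists v; split=> //; apply: eW.
rewrite -ball_normE /=; apply: le_lt_trans xv _.
by rewrite ltr_pdivrMr// ltr_pMr// ltr1n.
Qed.

End subspace.

Context (V W : normedModType K) (f : {linear V -> W}).

Lemma bounded_op_gt0 : bounded_op f ->
  exists2 M, 0 < M & forall x, `|f x| <= M * `|x|.
Proof.
(* On the zero space the given [M] may be negative or not even real, hence the case split. *)
move=> [M fM]; have [[x x0]|V0] := pselect (exists x : V, x != 0).
  have M0 : 0 <= M.
    by have := le_trans (normr_ge0 _) (fM x); rewrite pmulr_lge0// normr_gt0.
  exists (M + 1) => [|y]; first by rewrite ltr_wpDl.
  by rewrite mulrDl mul1r ler_wpDr.
exists 1 => // x; have /eqP -> : x == 0.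
  by apply: contraPT V0 => x0; apply; exists x.
by rewrite linear0 !normr0 mulr0.
Qed.

Lemma bounded_op_continuous : bounded_op f -> continuous f.
Proof.
move=> /bounded_op_gt0[M M0 fM].
apply: bounded_linear_continuous; apply/linear_boundedP.
near=> r => x; apply: le_trans (fM x) _; apply: ler_wpM2r => //.
by near: r; apply: nbhs_pinfty_ge; rewrite gtr0_real.
Unshelve. all: by end_near. Qed.

Lemma continuous_bounded_op : continuous f -> bounded_op f.
Proof.
move=> /linear_bounded_continuous/linear_boundedP/pinfty_ex_gt0[M M0 fM].
by exists M.
Qed.

Lemma csub_preimage_subproof (fc : continuous f) (L : closed_subspace W) :
  [/\ closed (f @^-1` csub_set L), (f @^-1` csub_set L) 0 & forall (a : K) u v,
      (f @^-1` csub_set L) u -> (f @^-1` csub_set L) v ->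
      (f @^-1` csub_set L) (a *: u + v)].
Proof.
split; first by move/continuous_closedP : fc; apply; exact: csub_closed.
  by rewrite /= linear0; exact: csub0.
by move=> a u v /= Lu Lv; rewrite linearP; exact: csubP.
Qed.

Definition csub_preimage (fc : continuous f) (L : closed_subspace W) :
    closed_subspace V :=
  let: And3 h1 h2 h3 := csub_preimage_subproof fc L in ClosedSubspace h1 h2 h3.

Lemma csub_preimageE (fc : continuous f) (L : closed_subspace W) v :
  csub_set (csub_preimage fc L) v <-> csub_set L (f v).
Proof. by rewrite /csub_preimage; case: csub_preimage_subproof. Qed.

End closed_subspaces.

(** * Locally constant sets and proper maps *)

Definition locally_constant (E : pred omega1) :=
  forall x, \forall y \near x, E y = E x.

Lemma locally_constant_le a : locally_constant (fun x => x <= a)%O.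
Proof.
move=> x; apply/nbhs_omega1P; have [xa|ax] := leP x a.
  by right=> y yx /=; rewrite (le_trans yx).
by left; exists a => // y /andP[ay _] /=; apply/negbTE; rewrite -ltNge.
Qed.

Lemma locally_constantN E : locally_constant E -> locally_constant (predC E).
Proof. by move=> Ec x; apply: filterS (Ec x) => y /= ->. Qed.

Lemma locally_constantI E F : locally_constant E -> locally_constant F ->
  locally_constant (predI E F).
Proof. by move=> Ec Fc x; apply: filterS2 (Ec x) (Fc x) => y /= -> ->. Qed.

Lemma locally_constant_itv a b : locally_constant (fun x => a < x <= b)%O.
Proof.
rewrite (_ : (fun x => _) = predI (predC (fun x => x <= a)%O) (fun x => x <= b)%O).
  by apply: locally_constantI; [apply: locally_constantN|];
    exact: locally_constant_le.
by apply/funext => x /=; rewrite -ltNge.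
Qed.

(** The second clause says that [h] tends to omega_1, so that composition with [h] preserves
    eventual vanishing. *)
Definition omega1_proper (h : omega1 -> omega1) :=
  continuous h /\ forall a, exists b, forall x, (b <= x)%O -> (a <= h x)%O.

Lemma normal_proper p : normal p -> omega1_proper p.
Proof.
move=> np; split; first exact: normal_continuous.
by move=> a; exists a => x ax; rewrite (le_trans ax)// normal_ge.
Qed.

Lemma block_proper p (np : normal p) : omega1_proper (block np).
Proof.
split; first exact: block_continuous.
move=> a; exists (p a) => x pax; apply: le_trans (block_mono np pax).
by rewrite block_normal.
Qed.

(** * Step functions and composition operators *)

Section C0.
Context (R : realType) (k : scalar_kind).
Local Notation K := (scalar_field R k).
Local Notation C0 := (C0_omega1 R k).
Implicit Types (f g : C0) (E : pred omega1) (x y z : omega1).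

Lemma C0_normr_ge f x : `|f x| <= `|f|. Proof. exact: C0_norm_ge. Qed.

Lemma C0_normr_le f M : (forall x, `|f x| <= M) -> `|f| <= M.
Proof. exact: C0_norm_le. Qed.

Lemma C0_addE f g x : (f + g) x = f x + g x. Proof. by []. Qed.
Lemma C0_oppE f x : (- f) x = - f x. Proof. by []. Qed.
Lemma C0_scaleE (c : K) f x : (c *: f) x = c * f x. Proof. by []. Qed.
Lemma C0_0E x : (0 : C0) x = 0. Proof. by []. Qed.
Definition C0E := (C0_addE, C0_oppE, C0_scaleE, C0_0E).

Lemma C0_sumE (I : Type) (s : seq I) (P : pred I) (F : I -> C0) x :
  (\sum_(i <- s | P i) F i) x = \sum_(i <- s | P i) F i x.
Proof. by apply: (big_morph (fun f : C0 => f x)). Qed.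

Lemma eqC0 f g : (forall x, f x = g x) -> f = g.
Proof. by move=> fg; apply/val_inj/funext. Qed.

(** Total, with value [0] outside the space, so that [cut] and [ind] carry no proof arguments. *)
Definition C0_of (g : omega1 -> K) : C0 := insubd (0 : C0) g.

Lemma C0_ofE (g : omega1 -> K) x : continuous g ->
  (exists a, forall b, (a <= b)%O -> g b = 0) -> C0_of g x = g x.
Proof.
move=> gc g0; have gC : g \in @C0_pred R k by apply/asboolP.
by have /(congr1 (fun h : omega1 -> K => h x)) := insubdK (0 : C0) gC.
Qed.

Definition cut E f := C0_of (fun x => if E x then f x else 0).

Lemma cutE E f x : locally_constant E -> cut E f x = if E x then f x else 0.
Proof.
move=> Ec; rewrite C0_ofE//.
  move=> y W Wy; have En := Ec y; case: (boolP (E y)) Wy => [Ey|/negbTE Ey] Wy.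
    by apply: filterS2 En (@C0_continuous R k f y W Wy) => z /= ->; rewrite Ey.
  by apply: filterS En => z /= ->; rewrite Ey; exact: nbhs_singleton Wy.
have [a fa] := C0_eventually0 f; exists a => b /fa ->; by case: ifP.
Qed.

Definition ind E := C0_of (fun x => (E x)%:R).

Lemma indE E x : locally_constant E -> (exists a, forall x, E x -> (x <= a)%O) ->
  ind E x = (E x)%:R.
Proof.
move=> Ec [a Ea]; rewrite C0_ofE//.
  move=> y W Wy; apply: filterS (Ec y) => z /= ->.
  exact: nbhs_singleton Wy.
have [b ab] := omega1_gt a; exists b => z bz; case: (boolP (E z)) => // /Ea.
by rewrite leNgt (lt_le_trans ab).
Qed.

Lemma ind_leE a x : ind (fun x => x <= a)%O x = (x <= a)%O%:R.
Proof. by rewrite indE//; [exact: locally_constant_le|exists a]. Qed.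

Lemma ind_itvE a b x : ind (fun x => a < x <= b)%O x = (a < x <= b)%O%:R.
Proof.
rewrite indE//; first exact: locally_constant_itv.
by exists b => z /andP[].
Qed.

(** Transfinite induction on [y] puts the truncation of [f] at [y] in [M]: near [y], on some
    [(z, y]], [f] is almost constant, so the truncation is close to that at [z] plus [f y] times an
    indicator. Finally [f] equals one of its truncations. *)
Lemma csub_step (M : closed_subspace C0) f :
  (forall y W, nbhs y W -> exists E, [/\ csub_set M (f y *: ind E),
     forall x, E x -> W x &
     (exists2 z, (z < y)%O & forall x, E x = (z < x <= y)%O) \/
     (forall x, E x = (x <= y)%O)]) -> csub_set M f.
Proof.
move=> Mf; have cutM y : csub_set M (cut (fun x => x <= y)%O f).
  elim/omega1_ind: y => y IH; apply: csub_approx => e e0.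
  have /cvgrPdist_le/(_ _ e0) fe := @C0_continuous R k f y.
  have [E [ME Ee [[z zy EE]|EE]]] := Mf y _ fe.
    exists (cut (fun x => x <= z)%O f + f y *: ind E).
      by apply: csubD => //; exact: IH.
    apply: C0_normr_le => x; rewrite !C0E !cutE; try exact: locally_constant_le.
    move: Ee; rewrite (_ : E = fun x => z < x <= y)%O; last exact/funext.
    rewrite ind_itvE => /(_ x); have [xz|zx] /= := leP x z.
      by move=> _; rewrite (le_trans xz (ltW zy)) mulr0 addr0 subrr normr0 ltW.
    have [xy|yx] /= := leP x y; last first.
      by move=> _; rewrite mulr0 addr0 subrr normr0 ltW.
    by move=> /(_ isT); rewrite mulr1 add0r distrC.
  exists (f y *: ind E) => //.
  apply: C0_normr_le => x; rewrite !C0E !cutE; try exact: locally_constant_le.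
  move: Ee; rewrite (_ : E = fun x => x <= y)%O; last exact/funext.
  rewrite ind_leE => /(_ x).
  have [xy|yx] /= := leP x y; last by move=> _; rewrite mulr0 subrr normr0 ltW.
  by move=> /(_ isT); rewrite mulr1 distrC.
have [a fa] := C0_eventually0 f.
rewrite (_ : f = cut (fun x => x <= a)%O f)//; apply: eqC0 => x.
rewrite cutE; last exact: locally_constant_le.
by case: leP => // /ltW/fa.
Qed.

Lemma csub_ind (M : closed_subspace C0) :
  (forall y, csub_set M (ind (fun x => x <= y)%O)) -> forall f, csub_set M f.
Proof.
move=> Mi f; apply: csub_step => y W /nbhs_omega1P[[z zy zW]|yW].
  exists (fun x => z < x <= y)%O; split=> //; last by left; exists z.
  apply: csubZ.
  rewrite (_ : ind _ = ind (fun x => x <= y)%O - ind (fun x => x <= z)%O).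
    exact: csubB.
  apply: eqC0 => x; rewrite !C0E ind_itvE !ind_leE.
  have [xz|zx] /= := leP x z; last by rewrite subr0.
  by rewrite (le_trans xz (ltW zy)) subrr.
by exists (fun x => x <= y)%O; split=> //; [exact: csubZ|right].
Qed.

Section comp.
Context (h : omega1 -> omega1) (hP : omega1_proper h).

Lemma C0_comp_subproof f : f \o h \in @C0_pred R k.
Proof.
apply/asboolP; split.
  by move=> x; apply: continuous_comp; [exact: hP.1|exact: C0_continuous].
have [a fa] := C0_eventually0 f; have [b hb] := hP.2 a.
by exists b => x /hb/fa.
Qed.

Definition C0_comp f : C0 := C0Omega1 (C0_comp_subproof f).

Lemma C0_comp_is_linear : linear C0_comp.
Proof. by move=> a f g; exact: eqC0. Qed.

HB.instance Definition _ :=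
  GRing.isLinear.Build K C0 C0 _ C0_comp C0_comp_is_linear.

Lemma C0_comp_norm f : `|C0_comp f| <= `|f|.
Proof. by apply: C0_normr_le => x; exact: (C0_normr_ge f (h x)). Qed.

Lemma C0_comp_bounded : bounded_op C0_comp.
Proof. by exists 1 => f; rewrite mul1r C0_comp_norm. Qed.

End comp.

(** * Block bumps *)

Section block_bump.
Context (p : omega1 -> omega1) (np : normal p).
Local Notation blk := (block np).

Definition block_init y : pred omega1 := fun x => (x <= y)%O && (blk x == blk y).

Lemma block_initP y : (y < p (blk y))%O ->
  (exists2 z, (z < y)%O & forall x, block_init y x = (z < x <= y)%O) \/
  (forall x, block_init y x = (x <= y)%O).
Proof.
move=> /block_start[h|[z zy h]]; [right=> x|left; exists (p z) => // x].
  by apply/andP/idP => [[]//|xy]; split=> //; apply/eqP/h.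
apply/andP/idP => [[xy /eqP bxy]|]; first exact/h.
by move=> /h[-> ->].
Qed.

(** The value is [0] at the end of a block because a limit block is a single point, whose indicator
    is discontinuous. All other bumps vanish on the range of [p]. *)
Definition block_bump y : C0 := if (y < p (blk y))%O then ind (block_init y) else 0.

Lemma block_bumpE y x : block_bump y x = ((y < p (blk y))%O && block_init y x)%:R.
Proof.
rewrite /block_bump; case: ifP => // yp; rewrite /= indE//; last first.
  by exists y => z /andP[].
have [[z zy /funext ->]|/funext ->] := block_initP yp.
  exact: locally_constant_itv.
exact: locally_constant_le.
Qed.

Lemma csub_bump (M : closed_subspace C0) f :
  (forall y, csub_set M (block_bump y)) -> (forall x, f (p x) = 0) -> csub_set M f.
Proof.
move=> Mb fp; apply: csub_step => y W yW.
(* At the end of a block [f] vanishes, so any interval inside [W] will do. *)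
have [yp|] := boolP (y < p (blk y))%O; last first.
  rewrite -leNgt => yp; have yE : y = p (blk y).
    by apply/eqP; rewrite eq_le yp -block_le lexx.
  have M0 E : csub_set M (f y *: ind E).
    by rewrite {1}yE fp scale0r; exact: csub0.
  move: yW => /nbhs_omega1P[[z zy zW]|yW].
    by exists (fun x => z < x <= y)%O; split=> //; left; exists z.
  by exists (fun x => x <= y)%O; split=> //; right.
have bumpy : block_bump y = ind (block_init y) by rewrite /block_bump yp.
have Mblk : csub_set M (f y *: ind (block_init y)).
  by apply: csubZ; rewrite -bumpy.
have bip : (exists2 z, (z < y)%O & forall x, block_init y x = (z < x <= y)%O) \/
  (forall x, block_init y x = (x <= y)%O) by exact: block_initP.
move: yW => /nbhs_omega1P[[z zy zW]|yW]; last first.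
  by exists (block_init y); split=> // x /andP[xy _]; exact: yW.
(* If [z] is in the block of [y], the indicator of [(z, y]] is a difference of two bumps; otherwise
   the whole block up to [y] lies in [W]. *)
have [bzy|/eqP bzy] := eqVneq (blk z) (blk y).
  exists (fun x => z < x <= y)%O; split=> //; last by left; exists z.
  apply: csubZ; rewrite (_ : ind _ = block_bump y - block_bump z); first exact: csubB.
  apply: eqC0 => x; rewrite !C0E !block_bumpE yp ind_itvE /=.
  rewrite bzy (lt_trans zy yp) /= /block_init bzy.
  have [xz|zx] /= := leP x z; last first.
    rewrite subr0; case: (boolP (x <= y)%O) => //= xy.
    by rewrite eq_le block_mono// -{1}bzy block_mono// ltW.
  by rewrite (le_trans xz (ltW zy)) /= subrr.
exists (block_init y); split=> // x /andP[xy /eqP bxy]; apply: zW.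
rewrite xy andbT ltNge; apply/negP => xz; apply: bzy.
have zy' := ltW zy; apply/eqP; rewrite eq_le block_mono//=.
rewrite -bxy; exact: block_mono.
Qed.

End block_bump.
End C0.

(** * The Hilbert space l_2(I) *)

Existing Instance totally_filter.

Section unordered_sums.
Context (I : choiceType) (K : numFieldType).

Section additive.
Context (V : zmodType).
Implicit Types (f g : I -> V) (s t : {fset I}).

Lemma partial_sumE f s : partial_sum f s = \sum_(i <- s) f i.
Proof. by rewrite /partial_sum big_seq_fsetE. Qed.

Lemma partial_sumID f s t : (s `<=` t)%fset ->
  partial_sum f t = partial_sum f s + partial_sum f (t `\` s)%fset.
Proof.
move=> st; rewrite !partial_sumE (big_fsetID _ (mem s)) /=; congr (_ + _).
  congr (bigop _ (enum_fset _) _); apply/fsetP => i; rewrite !inE /=.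
  by apply/andP/idP => [[]//|si]; split=> //; exact: (fsubsetP st).
congr (bigop _ (enum_fset _) _); apply/fsetP => i; rewrite !inE /=.
by rewrite andbC.
Qed.

Lemma partial_sumD f g s :
  partial_sum (f \+ g) s = partial_sum f s + partial_sum g s.
Proof. by rewrite !partial_sumE big_split. Qed.

End additive.

Lemma totally_ge (s0 : {fset I}) (P : {fset I} -> Prop) :
  (forall s, (s0 `<=` s)%fset -> P s) -> \forall s \near totally, P s.
Proof. by move=> h; exists s0. Qed.

(** The Cauchy criterion for unordered sums. Completeness is a hypothesis so that it applies to the
    scalars, through [scalar_complete], as well as to Banach spaces. *)
Lemma partial_sum_cvg (V : normedModType K) (f : I -> V)
  (Vc : forall F : set_system V, ProperFilter F -> cauchy F -> cvg F) :
  (forall e, 0 < e -> exists s0 : {fset I}, forall t : {fset I},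
     [disjoint t & s0]%fset -> `|partial_sum f t| <= e) ->
  cvg (partial_sum f @ totally).
Proof.
move=> fs; apply: Vc; apply/cauchy_ballP => e e0.
(* Two tails of size [e / 4] leave room for the strict inequality that balls require. *)
have e40 : 0 < e / 4 by rewrite divr_gt0.
have [s0 s0P] := fs _ e40.
pose A : set V := partial_sum f @` [set s | (s0 `<=` s)%fset].
have FA : (partial_sum f @ totally) A.
  by apply: (totally_ge (s0 := s0)) => s s0s; exists s.
exists (A, A) => // -[_ _] /= [[s s0s <-] [t s0t <-]].
rewrite -ball_normE /= (partial_sumID f s0s) (partial_sumID f s0t).
rewrite opprD addrACA subrr add0r.
apply: le_lt_trans (ler_normB _ _) _.
have disj u : [disjoint (u `\` s0)%fset & s0]%fset.
  by apply/fdisjointP => i; rewrite inE => /andP[].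
apply: le_lt_trans (lerD (s0P _ (disj _)) (s0P _ (disj _))) _.
rewrite -mulrDl ltr_pdivrMr// (_ : e + e = e * 2); last by ring.
by rewrite ltr_pM2l// ltr_nat.
Qed.

End unordered_sums.

Section scalar.
Context (R : realType) (k : scalar_kind).
Local Notation K := (scalar_field R k).
Implicit Types x y z : K.

Lemma scalar_sqrt x : 0 <= x -> exists2 y : K, 0 <= y & y ^+ 2 = x.
Proof.
case: k x => /= x x0; first by exists (Num.sqrt x); rewrite ?sqrtr_ge0// sqr_sqrtr.
by exists (sqrtC (x : R[i])); rewrite ?sqrtC_ge0// sqrtCK.
Qed.

Lemma ler_sqr_abs x y : 0 <= x -> 0 <= y -> (x ^+ 2 <= y ^+ 2) = (x <= y).
Proof. by move=> x0 y0; rewrite ler_pXn2r. Qed.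

Lemma normr_scalar_conj x : `|scalar_conj x| = `|x|.
Proof.
apply/eqP; rewrite -(@eqrXn2 _ 2)//.
by rewrite -!scalar_mul_conj scalar_conjK mulrC.
Qed.

Lemma sqr_normrD x y : `|x + y| ^+ 2 <= 2 * `|x| ^+ 2 + 2 * `|y| ^+ 2.
Proof.
apply: (@le_trans _ _ ((`|x| + `|y|) ^+ 2)).
  by rewrite ler_sqr_abs// ?addr_ge0// ler_normD.
rewrite -subr_ge0 (_ : _ - _ = `| `|x| - `|y| | ^+ 2) ?exprn_ge0//.
by rewrite [X in _ = X]real_normK ?rpredB ?normr_real//; ring.
Qed.

End scalar.

Section l2.
Context (R : realType) (k : scalar_kind) (I : choiceType).
Local Notation K := (scalar_field R k).
Implicit Types (s t : {fset I}).

Definition l2_pred : {pred I -> K} := [pred a : I -> K |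
  `[< exists M, forall s, partial_sum (fun i => `|a i| ^+ 2) s <= M >]].

Lemma partial_sum_ge0 (a : I -> K) s : (forall i, 0 <= a i) -> 0 <= partial_sum a s.
Proof. by move=> a0; rewrite partial_sumE sumr_ge0. Qed.

Lemma partial_sum_le (a b : I -> K) s : (forall i, a i <= b i) ->
  partial_sum a s <= partial_sum b s.
Proof. by move=> ab; rewrite !partial_sumE ler_sum. Qed.

Lemma partial_sumZ (c : K) (a : I -> K) s :
  partial_sum (fun i => c * a i) s = c * partial_sum a s.
Proof. by rewrite !partial_sumE mulr_sumr. Qed.

Record l2 := L2 { l2_fun :> I -> K ; l2_funP : l2_fun \in l2_pred }.

HB.instance Definition _ := [isSub for l2_fun].
HB.instance Definition _ := [Choice of l2 by <:].

Lemma l2_submod_closed : submod_closed l2_pred.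
Proof.
split.
  apply/asboolP; exists 0 => s.
  by rewrite partial_sumE big1// => i _; rewrite normr0 expr0n.
move=> c f g /asboolP[M fM] /asboolP[N gN]; apply/asboolP.
exists (2 * `|c| ^+ 2 * M + 2 * N) => s.
apply: (@le_trans _ _ (partial_sum
    ((fun i => 2 * `|c| ^+ 2 * `|f i| ^+ 2) \+ (fun i => 2 * `|g i| ^+ 2)) s)).
  apply: partial_sum_le => i /=; apply: le_trans (sqr_normrD _ _) _.
  by rewrite normrM exprMn mulrA.
rewrite partial_sumD !partial_sumZ lerD// ler_wpM2l//.
Qed.
HB.instance Definition _ :=
  GRing.isSubmodClosed.Build K (I -> K) l2_pred l2_submod_closed.
HB.instance Definition _ := [SubChoice_isSubLmodule of l2 by <:].
Implicit Types (a b : l2).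

Lemma l2_nsq_subproof a : exists q : K,
  supremums (range (partial_sum (fun i => `|a i| ^+ 2))) q.
Proof.
have [] := @scalar_supremums R k (range (partial_sum (fun i => `|a i| ^+ 2))).
- by exists (partial_sum (fun i => `|a i| ^+ 2) fset0), fset0.
- by move=> _ [s _ <-]; apply: partial_sum_ge0 => i; rewrite exprn_ge0.
- by have /asboolP[M aM] := l2_funP a; exists M => _ [s _ <-].
- by move=> q; exists q.
Qed.

(** The squared norm, as a supremum of finite sums; [l2_dotE] identifies it with the unordered
    sum. *)
Definition l2_nsq a : K := sval (cid (l2_nsq_subproof a)).

Lemma l2_nsq_ge a s : partial_sum (fun i => `|a i| ^+ 2) s <= l2_nsq a.
Proof. by rewrite /l2_nsq; case: cid => q /= [+ _]; apply; exists s. Qed.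

Lemma l2_nsq_le a M : (forall s, partial_sum (fun i => `|a i| ^+ 2) s <= M) ->
  l2_nsq a <= M.
Proof.
by move=> aM; rewrite /l2_nsq; case: cid => q /= [_]; apply => _ [s _ <-].
Qed.

Lemma l2_nsq_ge0 a : 0 <= l2_nsq a.
Proof.
apply: le_trans (l2_nsq_ge a fset0).
by apply: partial_sum_ge0 => i; rewrite exprn_ge0.
Qed.

Lemma l2_nsq_coord a i : `|a i| ^+ 2 <= l2_nsq a.
Proof.
by apply: le_trans (l2_nsq_ge a [fset i]%fset); rewrite partial_sumE big_seq_fset1.
Qed.

Lemma l2_nsq_near a e : 0 < e -> exists s0 : {fset I}, forall s,
  (s0 `<=` s)%fset -> l2_nsq a - e <= partial_sum (fun i => `|a i| ^+ 2) s.
Proof.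
move=> e0; pose S s := partial_sum (fun i => `|a i| ^+ 2) s.
have S0 s : 0 <= S s by apply: partial_sum_ge0 => i; rewrite exprn_ge0.
have [s0 s0P] : exists s0, l2_nsq a - e < S s0.
  apply: contrapT => /forallNP h.
  suff : l2_nsq a <= l2_nsq a - e.
    by rewrite lerDl oppr_ge0 => /(lt_le_trans e0); rewrite ltxx.
  apply: l2_nsq_le => s; have /negP := h s.
  rewrite -real_leNgt//; first exact: ger0_real.
  by apply: rpredB; apply: ger0_real; [exact: l2_nsq_ge0|exact: ltW].
exists s0 => s s0s; apply: le_trans (ltW s0P) _.
rewrite [leRHS](partial_sumID _ s0s) lerDl; apply: partial_sum_ge0 => i.
by rewrite exprn_ge0.
Qed.

(** The sum over [s0] already comes within [e] of the supremum, so a disjoint set can add at most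
    [e]. *)
Lemma l2_tail a e : 0 < e -> exists s0 : {fset I}, forall t,
  [disjoint t & s0]%fset -> partial_sum (fun i => `|a i| ^+ 2) t <= e.
Proof.
move=> /(l2_nsq_near a)[s0 s0P]; exists s0 => t ts0.
have := l2_nsq_ge a (s0 `|` t)%fset.
rewrite (partial_sumID _ (fsubsetUl s0 t)) => h.
have -> : t = ((s0 `|` t) `\` s0)%fset.
  by rewrite fsetDUl fsetDv fset0U; apply/esym/fsetDidPl.
rewrite -lerBrDl in h; apply: le_trans h _.
by rewrite lerBlDr -lerBlDl s0P.
Qed.

End l2.

(** The sides differ by [(B x - A y)^2 / (A B)]. With [A] and [B] the norms of two vectors,
    summation over coordinates gives the triangle inequality directly. *)
Lemma sqrrD_le (F : numFieldType) (x y A B : F) : x \is Num.real ->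
  y \is Num.real -> 0 < A -> 0 < B ->
  (x + y) ^+ 2 <= (A + B) / A * x ^+ 2 + (A + B) / B * y ^+ 2.
Proof.
move=> xr yr A0 B0; rewrite -subr_ge0.
rewrite (_ : _ - _ = `|B * x - A * y| ^+ 2 / (A * B)).
  by rewrite divr_ge0 ?exprn_ge0 ?mulr_ge0 ?(ltW A0) ?(ltW B0).
rewrite [X in _ = X / _]real_normK; last by rewrite rpredB ?rpredM// gtr0_real.
by field; rewrite !gt_eqF.
Qed.

Section l2_hilbert.
Context (R : realType) (k : scalar_kind) (I : choiceType).
Local Notation K := (scalar_field R k).
Local Notation H := (l2 R k I).
Implicit Types (a b d : H) (c : K).

Lemma l2_addE a b i : (a + b) i = a i + b i. Proof. by []. Qed.
Lemma l2_scaleE c a i : (c *: a) i = c * a i. Proof. by []. Qed.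

Lemma eq_l2 a b : (forall i, a i = b i) -> a = b.
Proof. by move=> ab; apply/val_inj/funext. Qed.

Definition l2_dot a b : K :=
  lim (partial_sum (fun i => a i * scalar_conj (b i)) @ totally).

(** Products are dominated by the sum of the two squares, whose tails are small. *)
Lemma l2_dot_cvg a b :
  partial_sum (fun i => a i * scalar_conj (b i)) @ totally --> l2_dot a b.
Proof.
apply: partial_sum_cvg; first exact: scalar_complete.
move=> e e0; have e20 : 0 < e / 2 by rewrite divr_gt0.
have [s1 s1P] := l2_tail a e20; have [s2 s2P] := l2_tail b e20.
exists (s1 `|` s2)%fset => t; rewrite fdisjointXU => /andP[ts1 ts2].
rewrite (splitr e); apply: le_trans (lerD (s1P _ ts1) (s2P _ ts2)).
rewrite -partial_sumD !partial_sumE; apply: le_trans (ler_norm_sum _ _ _) _.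
apply: ler_sum => i _ /=; rewrite normrM normr_scalar_conj.
apply: (@le_trans _ _ (2 * (`|a i| * `|b i|))).
  by rewrite ler_peMl ?mulr_ge0// ler1n.
rewrite -subr_ge0 (_ : _ - _ = `| `|a i| - `|b i| | ^+ 2) ?exprn_ge0//.
by rewrite [X in _ = X]real_normK ?rpredB ?normr_real//; ring.
Qed.

Lemma l2_dot_unique a b (l : K) :
  partial_sum (fun i => a i * scalar_conj (b i)) @ totally --> l -> l2_dot a b = l.
Proof.
move=> h; apply: (@cvg_lim K _ _ totally).
  exact: norm_hausdorff.
exact: h.
Qed.

Lemma l2_dotPl c a b d : l2_dot (c *: a + b) d = c * l2_dot a d + l2_dot b d.
Proof.
apply: l2_dot_unique.
rewrite (_ : partial_sum _ = fun s =>
  c * partial_sum (fun i => a i * scalar_conj (d i)) s +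
  partial_sum (fun i => b i * scalar_conj (d i)) s).
  by apply: cvgD; [apply: cvgMr|]; exact: l2_dot_cvg.
apply/funext => s; rewrite -partial_sumZ -partial_sumD; congr partial_sum.
by apply/funext => i; rewrite l2_addE l2_scaleE mulrDl -mulrA.
Qed.

Lemma l2_dotC a b : l2_dot a b = scalar_conj (l2_dot b a).
Proof.
apply: l2_dot_unique.
rewrite (_ : partial_sum _ = fun s =>
  scalar_conj (partial_sum (fun i => b i * scalar_conj (a i)) s)).
  apply/cvgrPdist_le => e e0; have /cvgrPdist_le/(_ e e0) := @l2_dot_cvg b a.
  by apply: filterS => s; rewrite -rmorphB normr_scalar_conj.
apply/funext => s; rewrite !partial_sumE rmorph_sum; apply: eq_bigr => i _.
by rewrite rmorphM/= scalar_conjK mulrC.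
Qed.

Lemma l2_dotPr c a b d :
  l2_dot d (c *: a + b) = scalar_conj c * l2_dot d a + l2_dot d b.
Proof. by rewrite l2_dotC l2_dotPl rmorphD rmorphM/= -!l2_dotC. Qed.

Lemma l2_dotE a : l2_dot a a = l2_nsq a.
Proof.
apply: l2_dot_unique; apply/cvgrPdist_le => e e0.
have [s0 s0P] := l2_nsq_near a e0; apply: (totally_ge (s0 := s0)) => s /s0P.
rewrite (_ : (fun i => _) = fun i => `|a i| ^+ 2); last first.
  by apply/funext => i; rewrite scalar_mul_conj.
by rewrite ger0_norm ?subr_ge0 ?l2_nsq_ge// lerBlDr lerBlDl addrC.
Qed.

Definition l2_norm a : K := s2val (cid2 (scalar_sqrt (l2_nsq_ge0 a))).

Lemma l2_norm_ge0 a : 0 <= l2_norm a.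
Proof. by rewrite /l2_norm; case: cid2. Qed.

Lemma l2_norm_sqr a : l2_norm a ^+ 2 = l2_nsq a.
Proof. by rewrite /l2_norm; case: cid2. Qed.

Lemma l2_norm_eq0 a : l2_norm a = 0 -> a = 0.
Proof.
move=> a0; apply: eq_l2 => i; apply/eqP; rewrite -normr_eq0 -sqrf_eq0 eq_le.
by rewrite exprn_ge0// andbT (le_trans (l2_nsq_coord a i))// -l2_norm_sqr a0 expr0n.
Qed.

Lemma l2_normZ c a : l2_norm (c *: a) = `|c| * l2_norm a.
Proof.
apply/eqP; rewrite -(@eqrXn2 _ 2)// ?mulr_ge0 ?l2_norm_ge0//.
rewrite exprMn !l2_norm_sqr -!l2_dotE -scalar_mul_conj.
have dot0 b : l2_dot b 0 = 0.
  by have := l2_dotPr (-1) 0 0 b; rewrite scaler0 addr0 rmorphN1 mulN1r addNr.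
have dot0l b : l2_dot 0 b = 0 by rewrite l2_dotC dot0 rmorph0.
by rewrite -[c *: a]addr0 l2_dotPl l2_dotPr dot0 dot0l !addr0 mulrA.
Qed.

Lemma l2_normD a b : l2_norm (a + b) <= l2_norm a + l2_norm b.
Proof.
set A := l2_norm a; set B := l2_norm b.
have [A0|A0] := eqVneq A 0; first by rewrite A0 (l2_norm_eq0 A0) !add0r.
have [B0|B0] := eqVneq B 0; first by rewrite B0 (l2_norm_eq0 B0) !addr0.
have A_gt0 : 0 < A by rewrite lt_neqAle eq_sym A0 l2_norm_ge0.
have B_gt0 : 0 < B by rewrite lt_neqAle eq_sym B0 l2_norm_ge0.
rewrite -ler_sqr_abs ?addr_ge0 ?l2_norm_ge0// l2_norm_sqr.
apply: l2_nsq_le => s; pose S d := partial_sum (fun i => `|d i| ^+ 2) s.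
apply: (@le_trans _ _ ((A + B) / A * S a + (A + B) / B * S b)).
  rewrite -!partial_sumZ -partial_sumD; apply: partial_sum_le => i /=.
  apply: (@le_trans _ _ ((`|a i| + `|b i|) ^+ 2)).
    by rewrite ler_sqr_abs ?addr_ge0// ler_normD.
  by apply: sqrrD_le; rewrite ?normr_real.
have -> : (A + B) ^+ 2 = (A + B) / A * A ^+ 2 + (A + B) / B * B ^+ 2.
  by rewrite !expr2 !mulrA !divfK// -mulrDr.
rewrite !l2_norm_sqr lerD// ler_wpM2l ?l2_nsq_ge//.
  by rewrite divr_ge0 ?addr_ge0 ?l2_norm_ge0.
by rewrite divr_ge0 ?addr_ge0 ?l2_norm_ge0.
Qed.

HB.instance Definition _ := Lmodule_isNormed.Build K H
  l2_normD l2_normZ l2_norm_eq0.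
HB.instance Definition _ := isPointed.Build H 0.

Lemma l2_normrE a : `|a| ^+ 2 = l2_nsq a. Proof. exact: l2_norm_sqr. Qed.

Lemma l2_coord a i : `|a i| <= `|a|.
Proof. by rewrite -ler_sqr_abs// l2_normrE l2_nsq_coord. Qed.

(** The limit [g] is coordinatewise. On a finite set [s], [g - a] is compared with [h - a] for some
    [h] in the filter close to [g] on [s]; the resulting bound does not depend on [s]. *)
Lemma l2_complete (F : set_system H) : ProperFilter F -> cauchy F -> cvg F.
Proof.
move=> FF /cauchy_ballP Fc.
have cvgi i : cvg ((fun a : H => a i) @ F).
  apply: scalar_complete; apply/cauchy_ballP => e /Fc [[A B] /= [FA FB] AB].
  exists ((fun a : H => a i) @` A, (fun a : H => a i) @` B) => /=.
    by split; [apply: filterS FA|apply: filterS FB] => z Hz; exists z.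
  move=> [_ _] /= [[u Au <-] [v Bv <-]].
  have := AB (u, v) (conj Au Bv); rewrite -!ball_normE /=.
  exact: le_lt_trans (l2_coord (u - v) i).
pose g i : K := lim ((fun a : H => a i) @ F).
have gP i e : 0 < e -> F [set a : H | `|g i - a i| <= e].
  by move=> e0; have /cvgrPdist_le/(_ _ e0) := cvgi i.
have near_g e : 0 < e -> exists2 A, F A & forall a, A a -> forall s,
    partial_sum (fun i => `|g i - a i| ^+ 2) s <= (2 * e) ^+ 2.
  move=> e0; have [[A B] /= [FA FB] AB] := Fc _ e0.
  exists A => // a Aa s.
  (* The terms [dl ^+ 2] over [s] add up to at most [e ^+ 2]; the successor keeps the divisor
     nonzero. *)
  pose dl : K := e / (#|` s|.+1)%:R.
  have dl0 : 0 < dl by rewrite divr_gt0.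
  have Fs : F (\bigcap_(i in [set` s]) [set h : H | `|g i - h i| <= dl]).
    by apply: filter_bigI => i _; exact: gP.
  have [h [Bh hs]] := filter_ex (filterI FB Fs).
  have ha : `|h - a| <= e.
    by have := AB (a, h) (conj Aa Bh); rewrite -ball_normE /= distrC => /ltW.
  apply: (@le_trans _ _ (partial_sum
      ((fun i => 2 * `|g i - h i| ^+ 2) \+ (fun i => 2 * `|(h - a) i| ^+ 2)) s)).
    apply: partial_sum_le => i /=; apply: le_trans (sqr_normrD _ _).
    by rewrite addrA subrK.
  rewrite partial_sumD !partial_sumZ.
  have -> : (2 * e) ^+ 2 = 2 * e ^+ 2 + 2 * e ^+ 2 by ring.
  rewrite lerD// ler_wpM2l//.
    apply: (@le_trans _ _ (\sum_(i <- s) dl ^+ 2)).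
      rewrite partial_sumE big_seq [leRHS]big_seq; apply: ler_sum => i si.
      by rewrite ler_sqr_abs ?(ltW dl0)//; exact: hs.
    rewrite big_const_seq count_predT iter_addr_0 -mulr_natl /dl expr_div_n.
    rewrite mulrCA ler_piMr ?exprn_ge0 ?(ltW e0)//.
    rewrite ler_pdivrMr ?exprn_gt0// mul1r -natrX ler_nat.
    by rewrite (leq_trans (leqnSn _))// expnS leq_pmulr// expn1.
  apply: le_trans (l2_nsq_ge _ _) _.
  by rewrite -l2_normrE ler_sqr_abs// ltW.
have gl2 : g \in @l2_pred R k I.
  have [A FA /= Ag] := near_g _ ltr01.
  have [a Aa] := filter_ex FA.
  have -> : g = (g \- a) \+ (a : I -> K).
    by apply/funext => i; rewrite /= subrK.
  have := rpredD (_ : (g \- a) \in @l2_pred R k I) (l2_funP a); apply.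
  by apply/asboolP; exists ((2 * 1) ^+ 2) => s; exact: Ag.
refine (proj2 (@cvg_ex _ F) _); exists (L2 gl2).
apply/cvgrPdist_le => e e0; have e20 : 0 < e / 2 by rewrite divr_gt0.
have [A FA Ag] := near_g _ e20; apply: filterS FA => a /Ag ag.
rewrite -ler_sqr_abs ?(ltW e0)// l2_normrE; apply: l2_nsq_le => s.
by apply: le_trans (ag s) _; rewrite mulrC divfK.
Qed.
HB.instance Definition _ := Uniform_isComplete.Build H l2_complete.

Lemma l2_dot_bilinear : bilinear_for
  (GRing.Scale.Law.clone _ _ ( *%R ) _)
  (GRing.Scale.Law.clone _ _ (@scalar_conj R k \; *%R ) _) l2_dot.
Proof.
split=> [u'|u] c x y /=; first exact: l2_dotPl.
exact: l2_dotPr.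
Qed.

HB.instance Definition _ := bilinear_isBilinear.Build K _ _ _
  (GRing.Scale.Law.clone _ _ ( *%R ) _)
  (GRing.Scale.Law.clone _ _ (@scalar_conj R k \; *%R ) _) l2_dot l2_dot_bilinear.

Lemma l2_dot_hermitian a b : l2_dot a b = (-1) ^+ false * scalar_conj (l2_dot b a).
Proof. by rewrite mul1r l2_dotC. Qed.

HB.instance Definition _ := @isHermitianSesquilinear.Build K H false
  (@scalar_conj R k) l2_dot l2_dot_hermitian.

Lemma l2_dot_gt0 a : a != 0 -> 0 < l2_dot a a.
Proof.
by move=> a0; rewrite l2_dotE -l2_normrE exprn_gt0// normr_gt0.
Qed.

HB.instance Definition _ := @isDotProduct.Build K H l2_dot l2_dot_gt0.

Lemma l2_is_hilbert : @is_hilbert R k H.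
Proof.
exists (l2_dot : {dot H for @scalar_conj R k}) => x /=.
by rewrite l2_dotE l2_normrE.
Qed.

End l2_hilbert.

(** * Density tested on closed subspaces *)

Section range_closure.
Context (K : numFieldType) (V W : normedModType K) (f : {linear V -> W}).

Let S : set W := [set x | forall e, 0 < e -> exists a, `|x - f a| <= e].

Lemma range_closure_subproof :
  [/\ closed S, S 0 & forall (c : K) u v, S u -> S v -> S (c *: u + v)].
Proof.
have half (e : K) : 0 < e -> 0 < e / 2 by move=> e0; rewrite divr_gt0.
split.
- move=> x Sx e e0; have e20 := half _ e0.
  have [v [Sv xv]] := Sx _ (nbhsx_ballx x (e / 2) e20).
  have [a va] := Sv _ e20; exists a.
  rewrite -ball_normE /= in xv; rewrite (splitr e) -(subrK v x) -addrA.
  by apply: le_trans (ler_normD _ _) _; rewrite lerD// ltW.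
- by move=> e e0; exists 0; rewrite linear0 subrr normr0 ltW.
- move=> c u v Su Sv e e0; have c0 : 0 < `|c| + 1 by rewrite ltr_wpDl.
  have [a ua] := Su _ (divr_gt0 (half _ e0) c0).
  have [b vb] := Sv _ (half _ e0).
  exists (c *: a + b); rewrite linearP opprD addrACA -scalerBr (splitr e).
  apply: le_trans (ler_normD _ _) _; rewrite lerD// normrZ.
  rewrite ler_pdivlMr// in ua; apply: le_trans ua.
  by rewrite mulrC ler_wpM2l// lerDl.
Qed.

(** The closure [S] of the range is a closed subspace, so the hypothesis applies to it. This form of
    density matches the conclusions of [csub_ind] and [csub_bump]. *)
Lemma dense_range : (forall L : closed_subspace W,
  (forall a, csub_set L (f a)) -> forall x, csub_set L x) -> dense (range f).
Proof.
have [h1 h2 h3] := range_closure_subproof.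
move=> /(_ (ClosedSubspace h1 h2 h3)) /= hL O [x Ox] Oo.
have Sx : S x.
  by apply: hL => a e e0; exists a; rewrite subrr normr0 ltW.
have /nbhs_ballP[e /= e0 eO] : nbhs x O by exact: open_nbhs_nbhs.
have e20 : 0 < e / 2 by rewrite divr_gt0.
have [a xa] := Sx _ e20; exists (f a); split; last by exists a.
apply: eO; rewrite -ball_normE /=; apply: le_lt_trans xa _.
by rewrite ltr_pdivrMr// ltr_pMr// ltr1n.
Qed.

End range_closure.

(** * Hilbert-generated spaces from families with an upper [c_0] estimate *)

Section synthesis.
Context (R : realType) (k : scalar_kind) (I : choiceType).
Local Notation K := (scalar_field R k).
Context (Y : completeNormedModType K) (u : I -> Y) (C : K) (C0 : 0 < C).
Hypothesis uC : forall (s : {fset I}) (c : I -> K) (B : K), 0 <= B ->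
  (forall i, i \in s -> `|c i| <= B) ->
  `|partial_sum (fun i => c i *: u i) s| <= C * B.
Local Notation H := (l2 R k I).
Implicit Types (a b : H).

(** The operator sending unit vectors to the [u i]. It is bounded since [uC] estimates sums by the
    largest coefficient, which is at most the [l_2] norm. *)
Definition synthesis a : Y := lim (partial_sum (fun i => a i *: u i) @ totally).

Lemma synthesis_cvg a :
  partial_sum (fun i => a i *: u i) @ totally --> synthesis a.
Proof.
apply: partial_sum_cvg; first by move=> F FF; exact: cauchy_cvg.
(* A tail of squares below [(e / C) ^+ 2] bounds each coordinate off [s0] by [e / C], which [uC]
   turns into [e]. *)
move=> e e0; have eC : 0 < (e / C) ^+ 2 by rewrite exprn_gt0// divr_gt0.
have [s0 s0P] := l2_tail a eC; exists s0 => t /s0P at_le.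
rewrite -[leRHS](divfK (lt0r_neq0 C0)) mulrC.
apply: uC => [|i it]; first by rewrite divr_ge0 ?ltW.
rewrite -ler_sqr_abs ?divr_ge0 ?(ltW e0) ?(ltW C0)//; apply: le_trans at_le.
rewrite partial_sumE (big_fsetD1 i)//= lerDl sumr_ge0//.
Qed.

Lemma synthesis_unique a (l : Y) :
  partial_sum (fun i => a i *: u i) @ totally --> l -> synthesis a = l.
Proof.
move=> h; apply: (@cvg_lim Y _ _ totally); first exact: norm_hausdorff.
exact: h.
Qed.

Lemma synthesis_is_linear : linear synthesis.
Proof.
move=> c a b; apply: synthesis_unique.
rewrite (_ : partial_sum _ = fun s =>
  c *: partial_sum (fun i => a i *: u i) s + partial_sum (fun i => b i *: u i) s).
  by apply: cvgD; [apply: cvgZr|]; exact: synthesis_cvg.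
apply/funext => s; rewrite !partial_sumE scaler_sumr -big_split.
by apply: eq_bigr => i _; rewrite l2_addE l2_scaleE scalerDl scalerA.
Qed.

HB.instance Definition _ :=
  GRing.isLinear.Build K H Y _ synthesis synthesis_is_linear.

Lemma synthesis_bounded : bounded_op synthesis.
Proof.
(* [C] bounds a partial sum and [1] its distance to the limit; the tolerance [|a|] must be positive,
   hence the case [a = 0]. *)
exists (C + 1) => a; have [->|a0] := eqVneq a 0.
  by rewrite linear0 !normr0 mulr0.
have a_gt0 : 0 < `|a| by rewrite normr_gt0.
have /cvgrPdist_le/(_ _ a_gt0) ha := @synthesis_cvg a.
have [s hs] := filter_ex ha.
rewrite -(subrK (partial_sum (fun i => a i *: u i) s) (synthesis a)).
apply: le_trans (ler_normD _ _) _; rewrite mulrDl mul1r addrC lerD//.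
by apply: uC => // i _; exact: l2_coord.
Qed.

Lemma l2_delta_subproof i : (fun j => (j == i)%:R : K) \in @l2_pred R k I.
Proof.
apply/asboolP; exists 1 => s; rewrite partial_sumE.
have [si|si] := boolP (i \in s); last first.
  rewrite big_seq big1// => j js; case: eqP => [ji|]; last by rewrite normr0 expr0n.
  by rewrite ji (negbTE si) in js.
rewrite (big_fsetD1 i)//= eqxx normr1 expr1n big_seq big1 ?addr0// => j.
by rewrite !inE => /andP[/negbTE -> _]; rewrite normr0 expr0n.
Qed.

Definition l2_delta i : H := L2 (l2_delta_subproof i).

Lemma synthesis_delta i : synthesis (l2_delta i) = u i.
Proof.
apply: synthesis_unique; apply: cvg_near_cst.
apply: (totally_ge (s0 := [fset i]%fset)) => s; rewrite fsub1set => si.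
rewrite partial_sumE (big_fsetD1 i)//= eqxx scale1r big_seq big1 ?addr0// => j.
by rewrite !inE => /andP[/negbTE -> _]; rewrite scale0r.
Qed.

Lemma hilbert_generated_family :
  (forall L : closed_subspace Y, (forall i, csub_set L (u i)) ->
     forall y, csub_set L y) ->
  hilbert_generated Y.
Proof.
move=> Yu; exists H, synthesis; split; first exact: l2_is_hilbert.
  exact: synthesis_bounded.
apply: dense_range => L Lf; apply: Yu => i.
by rewrite -synthesis_delta; exact: Lf.
Qed.

End synthesis.

Lemma geometric_le2 (F : numFieldType) (t : seq nat) : uniq t ->
  \sum_(n <- t) (2^-1 : F) ^+ n <= 2.
Proof.
move=> ut; have geo N : \sum_(0 <= n < N) (2^-1 : F) ^+ n = 2 - 2 * 2^-1 ^+ N.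
  elim: N => [|N IH]; first by rewrite big_nil expr0 mulr1 subrr.
  by rewrite big_nat_recr//= IH exprS; field.
pose N := (\max_(n <- t) n).+1.
have tN n : n \in t -> (n < N)%N by move=> nt; rewrite ltnS; exact: leq_bigmax_seq.
have -> : \sum_(n <- t) (2^-1 : F) ^+ n =
    \sum_(0 <= n < N | n \in t) (2^-1) ^+ n.
  rewrite -[RHS]big_filter; apply: perm_big; apply: uniq_perm => //.
    by rewrite filter_uniq// iota_uniq.
  move=> n; rewrite mem_filter mem_index_iota /=.
  by apply/idP/andP => [nt|[]//]; split=> //; exact: tN.
apply: (@le_trans _ _ (\sum_(0 <= n < N) (2^-1 : F) ^+ n)).
  rewrite big_mkcond /=; apply: ler_sum => n _; case: ifP => // _.
by rewrite geo gerBl mulr_ge0// exprn_ge0// invr_ge0.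
Qed.

(** * Images of the block bumps *)

Section bump_family.
Context (p : omega1 -> omega1) (np : normal p).
Local Notation blk := (block np).

(** The block over [a] lies below [p a], hence is countable: choose an injection into the naturals
    for each block. *)
Lemma block_code : exists code : omega1 -> nat,
  forall x y, blk x = blk y -> code x = code y -> x = y.
Proof.
have /choice[c cP] a : exists c : omega1 -> nat,
    {in [set x | (x <= p a)%O] &, injective c}.
  exact/countable_injP/omega1_countable_le.
exists (fun x => c (blk x) x) => x y bxy; rewrite -bxy; apply: cP.
  by rewrite inE /= -(block_le np).
by rewrite inE /= -(block_le np) bxy.
Qed.

Context (R : realType) (k : scalar_kind).
Local Notation K := (scalar_field R k).
Local Notation C0 := (C0_omega1 R k).

Lemma bump_sum (code : omega1 -> nat) (s : {fset omega1}) (c : omega1 -> K) (B : K) :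
  (forall x y, blk x = blk y -> code x = code y -> x = y) ->
  0 <= B -> (forall y, y \in s -> `|c y| <= B) ->
  `|partial_sum (fun y => c y *: (2^-1 ^+ code y *: block_bump R k np y)) s| <= 2 * B.
Proof.
move=> codeP B0 cB; apply: C0_normr_le => x.
rewrite partial_sumE C0_sumE; apply: le_trans (ler_norm_sum _ _ _) _.
apply: (@le_trans _ _ (\sum_(y <- s | blk y == blk x) B * 2^-1 ^+ code y)).
  rewrite [leRHS]big_mkcond big_seq [leRHS]big_seq; apply: ler_sum => y ys.
  rewrite !C0E block_bumpE /block_init eq_sym; case: eqP => _; last first.
    by rewrite !andbF !mulr0 normr0.
  rewrite andbT normrM; apply: ler_pM => //; first exact: cB.
  have h0 : 0 <= (2^-1 : K) ^+ code y by rewrite exprn_ge0// invr_ge0.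
  by case: (_ && _); rewrite ?mulr1 ?mulr0 ?normr0// ger0_norm.
rewrite -mulr_sumr mulrC ler_wpM2r//.
rewrite -big_filter -(big_map code xpredT (fun n => 2^-1 ^+ n)).
apply: geometric_le2; rewrite map_inj_in_uniq ?filter_uniq ?fset_uniq//.
move=> y z; rewrite !mem_filter => /andP[/eqP by_ _] /andP[/eqP bz _].
by apply: codeP; rewrite by_ bz.
Qed.

(* The weights make each block summable, and distinct blocks have disjoint
   supports: hence the [c_0] estimate of [bump_sum]. *)
Lemma hilbert_generated_bump (Y : completeNormedModType K) (T : {linear C0 -> Y}) :
  bounded_op T ->
  (forall L : closed_subspace Y, (forall y, csub_set L (T (block_bump R k np y))) ->
     forall x, csub_set L x) ->
  hilbert_generated Y.
Proof.
move=> /bounded_op_gt0[M M0 TM] TY; have [code codeP] := block_code.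
have M20 : 0 < M * 2 by rewrite mulr_gt0.
apply: (@hilbert_generated_family R k omega1 Y
  (fun y => T (2^-1 ^+ code y *: block_bump R k np y)) _ M20).
  move=> s c B B0 cB; rewrite partial_sumE.
  under eq_bigr do rewrite -linearZ.
  rewrite -linear_sum; apply: le_trans (TM _) _.
  rewrite -mulrA ler_wpM2l ?(ltW M0)//.
  by rewrite -partial_sumE; exact: bump_sum.
move=> L Lu; apply: TY => y; have := csubZ (2 ^+ code y) (Lu y).
by rewrite linearZ scalerA -exprMn divff// expr1n scale1r.
Qed.

End bump_family.

(** * The open mapping theorem *)

Section open_mapping.
Context (R : realType) (k : scalar_kind).
Local Notation K := (scalar_field R k).

Lemma half_expn_ge0 n : 0 <= (2^-1 : K) ^+ n.
Proof. by rewrite exprn_ge0// invr_ge0. Qed.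

Lemma half_expn_lt (e : K) : 0 < e -> exists n, 2^-1 ^+ n < e.
Proof.
move=> /scalar_archi[n ne]; exists n.+1; apply: le_lt_trans ne.
rewrite exprVn lef_pV2 ?posrE ?exprn_gt0// -natrX ler_nat.
exact/ltnW/ltn_expl.
Qed.

Lemma half_expn_bound (V : normedModType K) (x : V) (c : K) :
  (forall n, `|x| <= c * 2^-1 ^+ n) -> x = 0.
Proof.
move=> xc; apply/eqP; rewrite -normr_le0; apply/ler_addgt0Pr => e e0.
have c0 : 0 <= c by have := le_trans (normr_ge0 _) (xc 0%N); rewrite expr0 mulr1.
have c1 : 0 < c + 1 by rewrite ltr_wpDl.
have [n ne] := half_expn_lt (divr_gt0 e0 c1); rewrite add0r.
apply: le_trans (xc n) _; rewrite ltr_pdivlMr// mulrC in ne.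
by apply: le_trans (ltW ne); rewrite ler_wpM2r ?half_expn_ge0// lerDl.
Qed.

Lemma scalar_natr_ge (x : K) : 0 <= x -> exists n : nat, x <= n%:R.
Proof.
rewrite le_eqVlt => /orP[/eqP<-|x0]; first by exists 0%N.
have xV0 : 0 < x^-1 by rewrite invr_gt0.
have [n nx] := scalar_archi xV0; exists n.+1.
by rewrite ltW// -ltf_pV2 ?posrE.
Qed.

Lemma half_expn_cvg (V : completeNormedModType K) (v : nat -> V) (c : K) :
  (forall n, `|v n.+1 - v n| <= c * 2^-1 ^+ n) ->
  exists l, forall n, `|l - v n| <= 2 * c * 2^-1 ^+ n.
Proof.
move=> vc; have c0 : 0 <= c.
  by have := le_trans (normr_ge0 _) (vc 0%N); rewrite expr0 mulr1.
(* The exact geometric remainder makes the induction step an equality. *)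
have vj n j : `|v (n + j)%N - v n| <= 2 * c * (2^-1 ^+ n - 2^-1 ^+ (n + j)).
  elim: j => [|j IH]; first by rewrite addn0 !subrr normr0 mulr0.
  rewrite -(subrK (v (n + j)%N) (v (n + j.+1)%N)) -addrA.
  apply: le_trans (ler_normD _ _) _; rewrite addnS.
  apply: le_trans (lerD (vc _) IH) _; rewrite le_eqVlt; apply/orP; left; apply/eqP.
  by rewrite exprS; field.
have vm n m : (n <= m)%N -> `|v m - v n| <= 2 * c * 2^-1 ^+ n.
  move=> nm; rewrite -(subnKC nm); apply: le_trans (vj _ _) _.
  by rewrite ler_wpM2l ?mulr_ge0// gerBl half_expn_ge0.
have small e : 0 < e -> exists n, 2 * c * 2^-1 ^+ n <= e.
  move=> e0; have c1 : 0 < 2 * c + 1 by rewrite ltr_wpDl// mulr_ge0.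
  have [n ne] := half_expn_lt (divr_gt0 e0 c1); exists n.
  rewrite ltr_pdivlMr// mulrC in ne.
  by apply: le_trans (ltW ne); rewrite ler_wpM2r ?half_expn_ge0// lerDl.
have vcvg : cvg (v @ \oo).
  apply: cauchy_cvg; apply/cauchy_ballP => e e0.
  have e40 : 0 < e / 4 by rewrite divr_gt0.
  have [n ne] := small _ e40.
  pose A := v @` [set m | (n <= m)%N].
  have FA : (v @ \oo) A by exists n => // m nm; exists m.
  exists (A, A) => // -[_ _] /= [[m nm <-] [m' nm' <-]].
  rewrite -ball_normE /= -(subrK (v n) (v m)) -addrA.
  apply: le_lt_trans (ler_normD _ _) _; rewrite [ `|v n - _|]distrC.
  apply: le_lt_trans (lerD (le_trans (vm _ _ nm) ne) (le_trans (vm _ _ nm') ne)) _.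
  rewrite -mulrDl ltr_pdivrMr// (_ : e + e = e * 2); last by ring.
  by rewrite ltr_pM2l// ltr_nat.
exists (lim (v @ \oo)) => n; apply/ler_addgt0Pr => e e0.
have /cvgrPdist_le/(_ _ e0) lv := vcvg.
have [m [lm nm]] : exists m, `|lim (v @ \oo) - v m| <= e /\ (n <= m)%N.
  have h : \forall m \near \oo, (n <= m)%N by exists n.
  by have [m [? ?]] := filter_ex (filterI lv h); exists m.
rewrite -(subrK (v m) (lim _)) -addrA addrC.
by apply: le_trans (ler_normD _ _) _; rewrite lerD// vm.
Qed.

(** A substitute for the minimum: the order of [K] may be partial, but positive elements are real
    and so comparable. *)
Lemma exists_le2 (r e : K) : 0 < r -> 0 < e -> exists d, [/\ 0 < d, d <= r & d <= e].
Proof.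
move=> r0 e0; have [re|er] := real_leP (gtr0_real r0) (gtr0_real e0).
  by exists r.
by exists e; rewrite ltW.
Qed.

Context (V W : completeNormedModType K) (T : {linear V -> W}).
Hypotheses (T_bounded : bounded_op T) (T_surj : forall y, exists x, T x = y).

(** The closure of the image of the ball of radius [n]; by surjectivity these sets cover [W]. *)
Let S (n : nat) : set W :=
  [set y | forall e, 0 < e -> exists2 x, `|x| <= n%:R & `|y - T x| <= e].

Let baire : exists n y0 r, 0 < r /\ forall y, `|y - y0| <= r -> S n y.
Proof.
apply: contrapT => nbaire.
(* no closed ball lies in [S n]: nested balls that avoid [T x] for [|x| <= n] *)
have step n (s : W * K) : exists s' : W * K, 0 < s.2 ->
    [/\ 0 < s'.2, s'.2 <= s.2 / 2, `|s'.1 - s.1| <= s.2 / 2 &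
     forall z, `|z - s'.1| <= s'.2 -> forall x, `|x| <= n%:R -> z <> T x].
  have [s0|] := boolP (0 < s.2); last by exists s.
  have s20 : 0 < s.2 / 2 by rewrite divr_gt0.
  have [y ys nSy] : exists2 y, `|y - s.1| <= s.2 / 2 & ~ S n y.
    apply: contrapT => h; apply: nbaire; exists n, s.1, (s.2 / 2); split=> // y ys.
    by apply: contrapT => nS; apply: h; exists y.
  move/existsNP : nSy => [e /not_implyP[e0 ny]].
  have [d [d0 ds de]] := exists_le2 s20 e0.
  exists (y, d) => _; split=> //= z zy x xn zE; apply: ny; exists x => //.
  by rewrite -zE distrC (le_trans zy).
have /choice[g gP] : forall ns : nat * (W * K), exists s', _ :=
  fun ns => step ns.1 ns.2.
pose s := fix s n := if n is m.+1 then g (m, s m) else (0, 1).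
have s_gt0 n : 0 < (s n).2 by elim: n => //= n IH; have [] := gP (n, s n) IH.
have sP n := gP (n, s n) (s_gt0 n).
have s_half n : (s n).2 <= 2^-1 ^+ n.
  elim: n => [|n IH]; first by rewrite expr0.
  have [_ h _ _] := sP n; apply: le_trans h _ => /=.
  by rewrite exprS mulrC ler_wpM2l// invr_ge0.
have [l lP] : exists l, forall n, `|l - (s n).1| <= 2 * 1 * 2^-1 ^+ n.
  apply: half_expn_cvg => n; have [_ _ h _] := sP n; apply: le_trans h _ => /=.
  rewrite mul1r; apply: le_trans (s_half n).
  by rewrite ler_pdivrMr// ler_peMr ?ltW// ltr1n.
have half_sub (a h : K) : h / 2 + (a - h) = a - h / 2 by field.
(* Ball [n + m] lies in ball [n]: each step moves the centre by at most half the radius and keeps at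
   most half of it. *)
have sball m n : `|(s (n + m)%N).1 - (s n).1| <= (s n).2 - (s (n + m)%N).2.
  elim: m => [|m IH]; first by rewrite addn0 !subrr normr0.
  rewrite addnS -(subrK (s (n + m)%N).1 (s (n + m).+1).1) -addrA.
  have [_ h1 h2 _] := sP (n + m)%N.
  apply: le_trans (ler_normD _ _) _; apply: le_trans (lerD h2 IH) _ => /=.
  by rewrite half_sub lerD2l lerN2.
have lball n : `|l - (s n).1| <= (s n).2.
  apply/ler_addgt0Pr => e e0; have e20 : 0 < e / 2 by rewrite divr_gt0.
  have [m me] := half_expn_lt e20.
  rewrite -(subrK (s (n + m)%N).1 l) -addrA addrC.
  apply: le_trans (ler_normD _ _) _; apply: lerD.
    by apply: le_trans (sball m n) _; rewrite gerBl ltW.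
  apply: le_trans (lP _) _; rewrite mulr1 mulrC -ler_pdivlMr//.
  apply: le_trans (ltW me); rewrite addnC exprD ler_piMr ?half_expn_ge0//.
  by rewrite exprn_ile1// ?invr_ge0// invf_le1// ler1n.
have [x xl] := T_surj l; have [n xn] := scalar_natr_ge (normr_ge0 x).
have [_ _ _ /(_ l (lball n.+1) x xn)] := sP n; exact.
Qed.

(** Differences recentre the ball of [baire] at the origin and double the bound [n]. Scaling [y] to
    norm [r] and allowing the error [r / 2] gives a relative error of one half. *)
Let half_solve : exists2 C : K, 0 <= C &
  forall y, exists2 x, `|x| <= C * `|y| & `|y - T x| <= 2^-1 * `|y|.
Proof.
have [n [y0 [r [r0 Sball]]]] := baire.
have S2 y : `|y| <= r -> forall e, 0 < e ->
    exists2 x, `|x| <= n%:R + n%:R & `|y - T x| <= e.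
  move=> yr e e0; have e20 : 0 < e / 2 by rewrite divr_gt0.
  have [|x1 x1n h1] := Sball (y0 + y) _ _ e20; first by rewrite addrAC subrr add0r.
  have [|x2 x2n h2] := Sball y0 _ _ e20; first by rewrite subrr normr0 ltW.
  exists (x1 - x2); first by rewrite (le_trans (ler_normB _ _))// lerD.
  have -> : y - T (x1 - x2) = (y0 + y - T x1) - (y0 - T x2).
    rewrite linearB -[y0 + y - _]addrA !opprD !opprK [RHS]addrACA subrr add0r.
    by rewrite addrA.
  by rewrite (splitr e) (le_trans (ler_normB _ _))// lerD.
exists ((n%:R + n%:R) / r) => [|y]; first by rewrite divr_ge0// ltW.
have [->|y0'] := eqVneq y 0.
  exists 0; first by rewrite !normr0 mulr0.
  by rewrite linear0 subr0 normr0 mulr0.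
have y_gt0 : 0 < `|y| by rewrite normr_gt0.
pose t := r / `|y|; have t0 : 0 < t by rewrite divr_gt0.
have tu : t != 0 by rewrite gt_eqF.
have [||x xn xy] := S2 (t *: y) _ (r / 2).
- by rewrite normrZ gtr0_norm// /t divfK ?gt_eqF.
- by rewrite divr_gt0.
exists (t^-1 *: x).
  rewrite normrZ gtr0_norm ?invr_gt0// /t invf_div.
  rewrite [leRHS]mulrAC -[leRHS]mulrA [leLHS]mulrC ler_wpM2r//.
  by rewrite divr_ge0// ltW.
rewrite linearZ -[y in y - _](scalerK tu) -scalerBr normrZ gtr0_norm ?invr_gt0//.
apply: le_trans (ler_wpM2l _ xy) _; first by rewrite invr_ge0 ltW.
by rewrite /t invf_div mulrA divfK ?gt_eqF// mulrC.
Qed.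

(** Iterate [half_solve] on the residual: residuals tend to zero and the corrections sum to at most
    [2 * C * |y|]. The added [1] makes the constant positive. *)
Lemma open_mapping : exists2 C : K, 0 < C &
  forall y, exists2 x, T x = y & `|x| <= C * `|y|.
Proof.
have [M M0 TM] := bounded_op_gt0 T_bounded.
have [C C0 Cg] := half_solve.
have /choice[g gP] y : exists x, `|x| <= C * `|y| /\ `|y - T x| <= 2^-1 * `|y|.
  by have [x ? ?] := Cg y; exists x.
exists (2 * C + 1) => [|y]; first by rewrite ltr_wpDl// mulr_ge0.
pose v n := iter n (fun z => z - T (g z)) y.
have vn n : `|v n| <= `|y| * 2^-1 ^+ n.
  elim: n => [|n IH]; first by rewrite expr0 mulr1.
  rewrite exprS mulrCA; apply: le_trans (ler_wpM2l _ IH); last by rewrite invr_ge0.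
  by have [_] := gP (v n).
pose w n := \sum_(i < n) g (v i).
have [l lP] : exists l, forall n, `|l - w n| <= 2 * (C * `|y|) * 2^-1 ^+ n.
  apply: half_expn_cvg => n; rewrite /w big_ord_recr/= [_ + g _]addrC addrK.
  have [h _] := gP (v n); apply: le_trans h _.
  by rewrite -mulrA ler_wpM2l.
have Tw n : y - T (w n) = v n.
  elim: n => [|n IH]; first by rewrite /w big_ord0 linear0 subr0.
  by rewrite /w big_ord_recr/= linearD opprD addrA IH.
exists l.
  apply/eqP; rewrite eq_sym -subr_eq0; apply/eqP.
  apply: (@half_expn_bound _ _ (M * (2 * (C * `|y|)) + `|y|)) => n.
  rewrite -[X in X - T l](subrK (T (w n))) -addrA -linearB Tw.
  apply: le_trans (ler_normD _ _) _; rewrite mulrDl [leRHS]addrC lerD ?vn//.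
  apply: le_trans (TM _) _; rewrite -mulrA ler_wpM2l ?(ltW M0)//.
  by rewrite distrC.
rewrite mulrDl mul1r ler_wpDr//; have := lP 0%N.
by rewrite expr0 mulr1 /w big_ord0 subr0 mulrA.
Qed.

End open_mapping.

(** * The dichotomy *)

(** The constants of [C0_not_embedded]: each of its three errors contributes one quarter, so the
    total stays below [1]. *)
Lemma three_quarters (F : numFieldType) (c M : F) : 0 < c -> 0 < M ->
  c * ((4 * c)^-1 + (4 * c)^-1 + M * (2 * (8 * c * M)^-1)) = 3 / 4.
Proof. by move=> c0 M0; field; rewrite !gt_eqF. Qed.

(** * No embedding into a Hilbert-generated space *)

Section not_hilbert_generated.
Context (R : realType) (k : scalar_kind).
Local Notation K := (scalar_field R k).
Local Notation C0 := (C0_omega1 R k).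

Lemma parallelogram (H : completeNormedModType K) (x y : H) : is_hilbert H ->
  `|x + y| ^+ 2 + `|x - y| ^+ 2 = 2 * (`|x| ^+ 2 + `|y| ^+ 2).
Proof.
move=> [dot dotE].
have dotDl a b z : dot (a + b) z = dot a z + dot b z by exact: linearDl.
have dotDr z a b : dot z (a + b) = dot z a + dot z b by exact: linearDr.
have dotNl a z : dot (- a) z = - dot a z by exact: linearNl.
have dotNr z a : dot z (- a) = - dot z a by exact: linearNr.
by rewrite !dotE !dotDl !dotDr !dotNl !dotNr; ring.
Qed.

Lemma dense_range_approx (V W : normedModType K) (f : V -> W) (y : W) (e : K) :
  dense (range f) -> 0 < e -> exists x, `|y - f x| <= e.
Proof.
move=> fd e0; have [||z [ye [x _ xz]]] := fd (ball y e)°; last rewrite -xz in ye.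
- by exists y; apply: nbhsx_ballx.
- exact: open_interior.
exists x; have /= := interior_subset ye.
by rewrite -ball_normE /= => /ltW.
Qed.

Lemma C0_not_embedded (Y : completeNormedModType K) (J : {linear C0 -> Y}) (c : K) :
  hilbert_generated Y -> 0 < c -> (forall f, `|f| <= c * `|J f|) -> False.
Proof.
move=> [H [V [Hh /bounded_op_gt0[M M0 VM] Vd]]] c0 Jc.
pose e : K := (4 * c)^-1; have e0 : 0 < e by rewrite invr_gt0 mulr_gt0.
pose d : K := (8 * c * M)^-1; have d0 : 0 < d by rewrite invr_gt0 !mulr_gt0.
have d20 : 0 < d ^+ 2 by rewrite exprn_gt0.
pose Q g (u : C0) (h : H) := `|J u - V h| <= e /\ forall x, (x <= g)%O -> u x = 1.
(* A uniform bound on the lifts: otherwise countably many bad [g m] lie below some [b], and one lift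
   of the indicator of [[0, b]] serves them all. *)
have [m mP] : exists m : nat, forall g, exists u h, Q g u h /\ `|h| <= m%:R.
  apply: contrapT => /forallNP nm.
  have /choice[g gP] m : exists g, forall u h, Q g u h -> ~ `|h| <= m%:R.
    have /existsNP[g /forallNP gm] := nm m; exists g => u h Quh hm.
    by have /forallNP/(_ h) := gm u; apply.
  have [b gb] := omega1_countable_bounded g.
  have [h hP] := dense_range_approx (J (ind R k (fun x => x <= b)%O)) Vd e0.
  have [n hn] := scalar_natr_ge (normr_ge0 h).
  apply: (gP n _ h _ hn); split; first exact: hP.
  by move=> x xg; rewrite ind_leE (le_trans xg).
(* Squared norms are measured in steps of [d ^+ 2], so that a least natural number replaces an
   infimum in [K]. *)
pose P j := `[< forall g, exists u h, Q g u h /\ `|h| ^+ 2 <= j%:R * d ^+ 2 >].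
have exP : exists j, P j.
  have [|j jP] := @scalar_natr_ge R k (m%:R ^+ 2 / d ^+ 2).
    by rewrite divr_ge0// ?exprn_ge0// ltW.
  exists j; apply/asboolP => g; have [u [h [Quh hm]]] := mP g.
  exists u, h; split=> //; apply: (@le_trans _ _ (m%:R ^+ 2)).
    by rewrite ler_pXn2r ?nnegrE.
  by rewrite -ler_pdivrMr.
(* [j d^2] is, up to [d^2], the eventual value of the minimal squared norms *)
have [j /asboolP jP jmin] := ex_minnP exP.
have [g gP] : exists g, forall u h, Q g u h -> (j%:R - 1) * d ^+ 2 <= `|h| ^+ 2.
  (* For [j = 0] the lower bound is negative and any [g] will do; otherwise it comes from the
     minimality of [j]. *)
  case: j jP jmin => [|j] jP jmin.
    have [g] := omega1_0; exists g => u h _.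
    by rewrite sub0r mulN1r (@le_trans _ _ 0)// ?oppr_le0 ?exprn_ge0// ltW.
  have /negP/asboolP/existsNP[g /forallNP gj] : ~ P j.
    by move=> /jmin; rewrite ltnn.
  exists g => u h Quh; rewrite -addn1 natrD addrK ltW// real_ltNge ?ger0_real//.
  - by apply/negP => hj; have /forallNP/(_ h) := gj u; apply.
  - by rewrite mulr_ge0// ltW.
have [u [h [Quh hj]]] := jP g; have [a ua] := C0_eventually0 u.
(* Past the support of [u], [u'] is still [1] at [max g a], so the two functions are at distance at
   least [1]. *)
have [u' [h' [Quh' hj']]] := jP (Order.max g a).
pose x := 2^-1 *: h; pose y := 2^-1 *: h'.
(* The midpoint is again admissible for [g], so its squared norm is at least [(j - 1) * d ^+ 2]; the
   parallelogram law leaves at most [d ^+ 2] for the half-difference. *)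
have Qmid : Q g (2^-1 *: u + 2^-1 *: u') (x + y).
  split.
    rewrite /x /y !linearD !linearZ /= -!scalerDr normrZ gtr0_norm ?invr_gt0//.
    rewrite ler_pdivrMl// addrACA mulr_natl mulr2n.
    by apply: le_trans (ler_normD _ _) _; rewrite lerD//; case: Quh; case: Quh'.
  move=> z zg; rewrite !C0E (Quh.2 _ zg) (Quh'.2 z); last by rewrite le_max zg.
  by rewrite -mulrDr -(natrD _ 1 1) mulVf ?pnatr_eq0.
have norm_half (z : H) : `|2^-1 *: z| ^+ 2 = 4^-1 * `|z| ^+ 2.
  rewrite normrZ gtr0_norm ?invr_gt0// exprMn exprVn; congr (_^-1 * _).
  by rewrite -natrX.
have xy_le : `|x - y| <= d.
  rewrite -(@ler_pXn2r _ 2) ?nnegrE ?(ltW d0)//.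
  have := parallelogram x y Hh; rewrite !norm_half.
  have := gP _ _ Qmid; set p := `|x + y| ^+ 2; set q := `|x - y| ^+ 2 => pj pq.
  have -> : q = 2 * (4^-1 * `|h| ^+ 2 + 4^-1 * `|h'| ^+ 2) - p.
    by rewrite -pq addrAC subrr add0r.
  apply: le_trans (lerB (ler_wpM2l _ (lerD (ler_wpM2l _ hj) (ler_wpM2l _ hj'))) pj) _.
  - by [].
  - by rewrite invr_ge0.
  - by rewrite invr_ge0.
  rewrite le_eqVlt; apply/orP; left; apply/eqP; by field.
have a1 : 1 <= `|u' - u|.
  apply: le_trans (C0_normr_ge (u' - u) (Order.max g a)).
  rewrite !C0E (Quh'.2 _ (lexx _)) ua ?subr0 ?normr1//.
  by rewrite le_max lexx orbT.
have sub3 (a1' a2 a3 a4 : Y) : a1' - a2 = (a1' - a3) - (a2 - a4) - (a4 - a3).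
  by rewrite !opprB -addrA [a4 - a2 + _]addrC [a3 - a4 + _]addrA subrK addrA subrK.
have JE : J (u' - u) = (J u' - V h') - (J u - V h) - V (2 *: (x - y)).
  have -> : 2 *: (x - y) = h - h'.
    by rewrite /x /y -scalerBr scalerA divff ?pnatr_eq0// scale1r.
  by rewrite (linearB J) (linearB V); exact: sub3.
have : `|u' - u| <= c * (e + e + M * (2 * d)).
  apply: le_trans (Jc _) _; rewrite ler_wpM2l ?(ltW c0)// JE.
  apply: le_trans (ler_normB _ _) _; apply: lerD.
    by apply: le_trans (ler_normB _ _) _; apply: lerD; [case: Quh'|case: Quh].
  apply: le_trans (VM _) _; rewrite ler_wpM2l ?(ltW M0)// normrZ.
  by rewrite ger0_norm// ler_wpM2l.
move=> /(le_trans a1); rewrite three_quarters//.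
by rewrite ler_pdivlMr// mul1r ler_nat.
Qed.

End not_hilbert_generated.

(** * Bounded common zeros of the kernel *)

Section small_zero_set.
Context (R : realType) (k : scalar_kind).
Local Notation K := (scalar_field R k).
Local Notation C0 := (C0_omega1 R k).
Context (X : completeNormedModType K) (T : {linear C0 -> X}).
Hypotheses (T_bounded : bounded_op T) (T_surj : forall x, exists f, T f = x).

(** If each [g] failed at some [B g], take [d > b] closed under [B] and a kernel element normalised
    to [1] at [d]. By continuity it is close to [1] on some [(z, d]], which contains [(z, B z]]. *)
Lemma kernel_near1 (b : omega1) (e : K) :
  (forall a, (b < a)%O -> exists2 f, T f = 0 & f a != 0) -> 0 < e ->
  exists g, forall d, exists2 f, T f = 0 &
    forall x, (g < x <= d)%O -> `|f x - 1| <= e.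
Proof.
move=> Tb e0; apply: contrapT => /forallNP nT.
have /choice[B BP] g : exists d, forall f, T f = 0 ->
    ~ forall x, (g < x <= d)%O -> `|f x - 1| <= e.
  have /existsNP[d dP] := nT g; exists d => f Tf h; apply: dP.
  by exists f.
have [d bd dB] := omega1_closure_point B b.
have [f Tf fd0] := Tb d bd.
have Tg : T ((f d)^-1 *: f) = 0 by rewrite linearZ /= Tf scaler0.
have /cvgrPdist_le/(_ _ e0) := @C0_continuous R k ((f d)^-1 *: f) d.
rewrite C0E mulVf// => /nbhs_omega1P[[z zd h]|h].
  apply: (BP z _ Tg) => x /andP[zx xB]; rewrite distrC; apply: h.
  by rewrite zx (le_trans xB)// ltW// dB.
apply: (BP b _ Tg) => x /andP[_ xB]; rewrite distrC; apply: h.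
by rewrite (le_trans xB)// ltW// dB.
Qed.

(** Countability is used twice: [c] serves all tolerances at once, and [h d] lies past the supports
    of all [f (d, n)]. On the club of points above [c] closed under [h], [f (p a, n)] is near [1] at
    [p x] for [x <= a] and vanishes at [p x] for [x > a]. *)
Lemma kernel_club (b : omega1) :
  (forall a, (b < a)%O -> exists2 f, T f = 0 & f a != 0) ->
  exists2 p, normal p & forall a (e : K), 0 < e -> exists2 f, T f = 0 &
    forall x, `|(x <= a)%O%:R - f (p x)| <= e.
Proof.
move=> Tb.
have eps_gt0 n : 0 < n.+1%:R^-1 :> K by rewrite invr_gt0.
have /choice[g gP] n := kernel_near1 Tb (eps_gt0 n).
have [c gc] := omega1_countable_bounded g.
have /choice[f fP] (dn : omega1 * nat) : exists f, T f = 0 /\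
    forall x, (c < x <= dn.1)%O -> `|f x - 1| <= dn.2.+1%:R^-1.
  have [f Tf fd] := gP dn.2 dn.1; exists f; split=> // x /andP[cx xd].
  by apply: fd; rewrite (le_lt_trans (gc _) cx).
have /choice[h hP] d : exists h, forall n x, (h <= x)%O -> f (d, n) x = 0.
  have /choice[s sP] n := C0_eventually0 (f (d, n)).
  have [h sh] := omega1_countable_bounded s; exists h => n x hx.
  by rewrite sP// (le_trans (sh n)).
have [|p np pD] := @club_enum
  [set d | (c < d)%O /\ forall x, (x < d)%O -> (h x < d)%O].
  split=> [y|y [x0 x0y] yD].
    have [d d1 d2] := omega1_closure_point h (Order.max c y).
    by move: d1; rewrite gt_max => /andP[? ?]; exists d.
  split=> [|x xy].
    have [d [cd _] /andP[_ dy]] := yD _ x0y; exact: lt_le_trans dy.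
  by have [d [_ /(_ x) dh] /andP[xd dy]] := yD _ xy; exact: lt_le_trans (dh xd) dy.
exists p => // a e /scalar_archi[n ne].
have [Tf fd] := fP (p a, n); exists (f (p a, n)) => // x.
have [cpx pxh] := pD x; case: leP => [xa|ax].
  rewrite distrC; apply: le_trans (ltW ne); apply: fd.
  by rewrite cpx (normal_le np).
have hpx : (h (p a) < p x)%O by apply: pxh; exact: normal_lt.
rewrite hP; last exact: ltW.
by rewrite subrr normr0 ltW// (lt_trans _ ne).
Qed.

(** The pullback [M] of [L] contains [ker T] and every [f - A (P f)], which vanishes on the range of
    [p]. To get the range of [A] as well, indicators suffice: their images are limits of [A (P u)]
    with [u] in the kernel. *)
Lemma quotient_hilbert_generated (b : omega1) :
  (forall a, (b < a)%O -> exists2 f, T f = 0 & f a != 0) -> hilbert_generated X.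
Proof.
move=> /kernel_club[p np pT].
have Tc := bounded_op_continuous T_bounded.
apply: (hilbert_generated_bump (np := np) T_bounded) => L Lbump.
pose M := csub_preimage Tc L.
have Mker (f : C0) : (forall x, f (p x) = 0) -> csub_set M f.
  by apply: (csub_bump (np := np)) => y; exact/csub_preimageE.
pose A : {linear C0 -> C0} := C0_comp (block_proper np).
pose P : {linear C0 -> C0} := C0_comp (normal_proper np).
have Ac : continuous A by apply: bounded_op_continuous; exact: C0_comp_bounded.
have MsubA (f : C0) : csub_set M (f - A (P f)).
  apply: Mker => x; rewrite C0_addE C0_oppE.
  have -> : A (P f) (p x) = f (p (block np (p x))) by [].
  by rewrite block_normal subrr.
have MA (f : C0) : csub_set (csub_preimage Ac M) f.
  apply: csub_ind => a; apply/csub_preimageE; apply: csub_approx => e e0.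
  have [u Tu uP] := pT a _ e0; exists (A (P u)).
    rewrite (_ : A (P u) = u - (u - A (P u))); last by rewrite opprB addrC subrK.
    by apply: csubB => //; apply/csub_preimageE; rewrite Tu; exact: csub0.
  rewrite -linearB; apply: le_trans (C0_comp_norm _ _) _.
  by apply: C0_normr_le => x; rewrite !C0E ind_leE.
move=> x; have [f <-] := T_surj x; apply/(csub_preimageE Tc).
rewrite -(subrK (A (P f)) f); apply: csubD => //.
by apply/(csub_preimageE Ac); exact: MA.
Qed.

End small_zero_set.

(** * Kernels, corestrictions and direct sums *)

Lemma zero_csub_subproof (K : numFieldType) (Y : normedModType K) :
  [/\ closed [set 0 : Y], [set 0 : Y] 0 & forall (a : K) u v,
    [set 0 : Y] u -> [set 0 : Y] v -> [set 0 : Y] (a *: u + v)].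
Proof.
split=> //; last by move=> a u v -> -> /=; rewrite scaler0 addr0.
exact: (accessible_closed_set1 (hausdorff_accessible (@norm_hausdorff _ Y))).
Qed.

Definition zero_csub (K : numFieldType) (Y : normedModType K) : closed_subspace Y :=
  let: And3 h1 h2 h3 := zero_csub_subproof Y in ClosedSubspace h1 h2 h3.

Lemma zero_csubE (K : numFieldType) (Y : normedModType K) (y : Y) :
  csub_set (zero_csub Y) y <-> y = 0.
Proof. by rewrite /zero_csub; case: zero_csub_subproof. Qed.

(** Serves where a subspace is required and the whole space is meant: [X] in itself for (I), the
    complementary summand for (II). *)
Definition full_csub (K : numFieldType) (Y : normedModType K) : closed_subspace Y :=
  @ClosedSubspace K Y setT closedT I (fun _ _ _ _ _ => I).

Section csub_embedding.
Context (K : numFieldType) (Y : normedModType K) (S : closed_subspace Y).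

Lemma csub_val_is_linear : linear (@csub_val K Y S).
Proof. by []. Qed.
HB.instance Definition _ :=
  GRing.isLinear.Build K (csub_type S) Y _ (@csub_val K Y S) csub_val_is_linear.

Lemma csub_val_continuous : continuous (@csub_val K Y S).
Proof. by apply: bounded_op_continuous; exists 1 => x; rewrite mul1r. Qed.

Lemma csub_valE (x : csub_type S) : csub_set S (csub_val x).
Proof. by have /asboolP := csub_valP x. Qed.

Context (V : normedModType K) (f : {linear V -> Y}).
Hypothesis fS : forall v, csub_set S (f v).

Definition csub_corestr (v : V) : csub_type S :=
  CsubType (introT (asboolP _) (fS v)).

Lemma csub_corestr_is_linear : linear csub_corestr.
Proof. by move=> a u v; apply/val_inj; exact: linearP. Qed.
HB.instance Definition _ :=
  GRing.isLinear.Build K V (csub_type S) _ csub_corestr csub_corestr_is_linear.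

Lemma csub_corestr_bounded : bounded_op f -> bounded_op csub_corestr.
Proof. by []. Qed.

End csub_embedding.

Lemma isomorphic_full_csub (K : numFieldType) (Y : normedModType K) :
  isomorphic Y (csub_type (full_csub Y)).
Proof.
pose i : {linear Y -> csub_type (full_csub Y)} :=
  csub_corestr (S := full_csub Y) (f := idfun) (fun=> I).
exists i, (@csub_val K Y (full_csub Y)); split.
- by [].
- by move=> x; apply/val_inj.
- by apply/bounded_op_continuous/csub_corestr_bounded; exists 1 => x; rewrite mul1r.
- exact: csub_val_continuous.
Qed.

Lemma isomorphic_prod_full (K : numFieldType) (X V Y : normedModType K)
    (P : {linear X -> V}) (Q : {linear X -> Y})
    (F : {linear V -> X}) (G : {linear Y -> X}) :
  continuous P -> continuous Q -> continuous F -> continuous G ->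
  (forall x, F (P x) + G (Q x) = x) ->
  (forall v y, P (F v + G y) = v) -> (forall v y, Q (F v + G y) = y) ->
  isomorphic X (V * csub_type (full_csub Y))%type.
Proof.
move=> Pc Qc Fc Gc FGPQ PFG QFG.
pose i : {linear X -> csub_type (full_csub Y)} :=
  csub_corestr (S := full_csub Y) (f := Q) (fun=> I).
pose f x : V * csub_type (full_csub Y) := (P x, i x).
have fl : linear f.
  by move=> a x y; rewrite /f (linearP P) (linearP i).
pose g (z : V * csub_type (full_csub Y)) : X := F z.1 + G (csub_val z.2).
have gl : linear g.
  move=> a x y; rewrite /g (linearP F) (linearP (@csub_val _ _ _)) (linearP G).
  by rewrite scalerDr addrACA.
pose f' : {linear X -> (V * csub_type (full_csub Y))%type} :=
  HB.pack f (GRing.isLinear.Build _ _ _ _ _ fl).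
pose g' : {linear (V * csub_type (full_csub Y))%type -> X} :=
  HB.pack g (GRing.isLinear.Build _ _ _ _ _ gl).
exists f', g'; split.
- by move=> x; exact: FGPQ.
- move=> [v y]; rewrite /= /f /g /= PFG; congr pair.
  by apply/val_inj => /=; rewrite QFG.
- have ic : continuous i.
    by apply/bounded_op_continuous/csub_corestr_bounded/continuous_bounded_op.
  by move=> x; exact: (cvg_pair (Pc x) (ic x)).
- have vc : continuous (@csub_val _ _ (full_csub Y)) by exact: csub_val_continuous.
  move=> [v y].
  have c1 : F z.1 @[z --> (v, y)] --> F v.
    exact: (cvg_comp _ _ (@cvg_fst _ _ (nbhs v) (nbhs y) _) (Fc v)).
  have c2 : csub_val z.2 @[z --> (v, y)] --> csub_val y.
    exact: (cvg_comp _ _ (@cvg_snd _ _ (nbhs v) (nbhs y) _) (vc y)).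
  have c3 : G (csub_val z.2) @[z --> (v, y)] --> G (csub_val y).
    exact: (cvg_comp _ _ c2 (Gc (csub_val y))).
  exact: cvgD c1 c3.
Qed.

(** * Unbounded common zeros of the kernel *)

Section splitting.
Context (R : realType) (k : scalar_kind).
Local Notation K := (scalar_field R k).
Local Notation C0 := (C0_omega1 R k).
Context (X : completeNormedModType K) (T : {linear C0 -> X}).
Hypotheses (T_bounded : bounded_op T) (T_surj : forall x, exists f, T f = x).

Lemma kernel_zeros_club :
  (forall b, exists2 a, (b < a)%O & forall f, T f = 0 -> f a = 0) ->
  club [set a | forall f, T f = 0 -> f a = 0].
Proof.
move=> zeros; split=> [y|y [x0 x0y] yD f Tf].
  by have [a ya fa] := zeros y; exists a.
apply/eqP; apply: contraT => fy.
have fy0 : 0 < `|f y| by rewrite normr_gt0.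
have /cvgrPdist_lt/(_ _ fy0) := @C0_continuous R k f y.
have bad d : (d <= y)%O -> (forall g, T g = 0 -> g d = 0) ->
    `|f y - f d| < `|f y| -> False.
  by move=> dy fd; rewrite fd// subr0 ltxx.
move=> /nbhs_omega1P[[z zy zW]|yW].
  have [d Dd /andP[zd dy]] := yD _ zy.
  by case: (bad d dy Dd); apply: zW; rewrite zd.
have [d Dd /andP[_ dy]] := yD _ x0y.
by case: (bad d dy Dd); exact: yW.
Qed.

Lemma quotient_split :
  (forall b, exists2 a, (b < a)%O & forall f, T f = 0 -> f a = 0) ->
  factors_through (idfun : {linear C0 -> C0}) T /\
  exists (Y : completeNormedModType K) (Z : closed_subspace Y),
    hilbert_generated Y /\ isomorphic X (C0 * csub_type Z)%type.
Proof.
move=> /kernel_zeros_club/club_enum[p np pD].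
pose A : {linear C0 -> C0} := C0_comp (block_proper np).
pose P : {linear C0 -> C0} := C0_comp (normal_proper np).
have PE f x : P f x = f (p x) by [].
have PA f : P (A f) = f.
  apply: eqC0 => x; have -> : P (A f) x = f (block np (p x)) by [].
  by rewrite block_normal.
have A_bounded : bounded_op A by exact: C0_comp_bounded.
have P_norm f : `|P f| <= `|f| by exact: C0_comp_norm.
clearbody A P.
have Pker f : T f = 0 -> P f = 0.
  by move=> Tf; apply: eqC0 => x; rewrite PE; exact: pD.
have [C C_gt0 TC] := open_mapping T_bounded T_surj.
(* The chosen preimages need not depend linearly on [x], but [P (g x)] does: two preimages differ by
   a kernel element, which [P] kills. *)
have /choice[g gP] x : exists f, T f = x /\ `|f| <= C * `|x|.
  by have [f ? ?] := TC x; exists f.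
have Tg x : T (g x) = x by case: (gP x).
have Ul : linear (fun x => P (g x)).
  move=> a x y; apply/eqP; rewrite -subr_eq0 -linearP -linearB; apply/eqP.
  by apply: Pker; rewrite linearB linearP !Tg subrr.
pose U : {linear X -> C0} :=
  HB.pack (fun x => P (g x)) (GRing.isLinear.Build _ _ _ _ _ Ul).
have UT f : U (T f) = P f.
  apply/eqP; rewrite -subr_eq0 -[U _]/(P (g (T f))) -linearB; apply/eqP.
  by apply: Pker; rewrite linearB Tg subrr.
have U_bounded : bounded_op U.
  by exists C => x; apply: le_trans (P_norm _) _; case: (gP x).
clearbody U.
split; first by exists A, U; split=> // f; rewrite UT PA.
have Tc := bounded_op_continuous T_bounded.
have Ac := bounded_op_continuous A_bounded.
have Uc := bounded_op_continuous U_bounded.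
(* [F] is a right inverse of [U], so [x - F (U x)] projects [X] onto [ker U] along a copy of the
   function space. *)
pose F : {linear C0 -> X} := T \o A.
have FE v : F v = T (A v) by [].
have Fc : continuous F.
  by move=> v; apply: continuous_comp; [exact: Ac|exact: Tc].
clearbody F.
have UF v : U (F v) = v by rewrite FE UT PA.
have Q0l : linear (fun x => x - F (U x)).
  by move=> a x y; rewrite (linearP U) (linearP F) opprD addrACA scalerBr.
pose Q0 : {linear X -> X} :=
  HB.pack (fun x => x - F (U x)) (GRing.isLinear.Build _ _ _ _ _ Q0l).
have Q0E x : Q0 x = x - F (U x) by [].
have Q0c : continuous Q0.
  move=> x; have h : F (U z) @[z --> x] --> F (U x).
    exact: (cvg_comp _ _ (Uc x) (Fc (U x))).
  exact: (cvgB (@cvg_id _ (nbhs x)) h).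
clearbody Q0.
pose Z := csub_preimage Uc (zero_csub C0).
have ZP x : csub_set Z x <-> U x = 0.
  by split=> [/csub_preimageE/zero_csubE//|Ux]; apply/csub_preimageE/zero_csubE.
have Q0Z x : csub_set Z (Q0 x) by apply/ZP; rewrite Q0E (linearB U) UF subrr.
pose Y : completeNormedModType K := csub_type Z.
pose Q : {linear X -> Y} := csub_corestr Q0Z.
pose G : {linear Y -> X} := @csub_val _ _ Z.
have GQ x : G (Q x) = x - F (U x) by rewrite -Q0E.
have UG y : U (G y) = 0 by apply/ZP; exact: csub_valE.
have Ginj : injective G by exact: val_inj.
have Gc : continuous G by exact: csub_val_continuous.
have Qc : continuous Q.
  by apply/bounded_op_continuous/csub_corestr_bounded/continuous_bounded_op.
clearbody G Q.
exists Y, (full_csub Y); split; last first.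
  apply: (isomorphic_prod_full Uc Qc Fc Gc) => [x|v y|v y].
  - by rewrite GQ addrC subrK.
  - by rewrite (linearD U) UF UG addr0.
  - by apply: Ginj; rewrite GQ (linearD U) UF UG addr0 addrC addKr.
pose QT : {linear C0 -> Y} := Q \o T.
have QTE f : QT f = Q (T f) by [].
have QTc : continuous QT.
  by move=> v; apply: continuous_comp; [exact: Tc|exact: Qc].
clearbody QT.
(* A preimage [f] of an element of [ker U] has [P f = 0], so it lies in the closed span of the
   bumps. *)
apply: (hilbert_generated_bump (np := np) (continuous_bounded_op QTc)) => L LQ y.
have [f fy] := T_surj (G y).
have Pf : P f = 0 by rewrite -UT fy UG.
have : csub_set (csub_preimage QTc L) f.
  apply: (csub_bump (np := np)) => [x|x]; first exact/csub_preimageE.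
  by rewrite -PE Pf.
move/csub_preimageE; rewrite QTE fy; congr (csub_set L _).
by apply: Ginj; rewrite GQ UG linear0 subr0.
Qed.

(** Since [U] inverts [T \o A] on the left and [g] inverts [f], the composite [J] into [Y] is
    bounded below, with constant [M * N]. *)
Lemma not_both :
  factors_through (idfun : {linear C0 -> C0}) T ->
  (exists Y : completeNormedModType K, hilbert_generated Y /\ embeds X Y) -> False.
Proof.
move=> [A [U [A_bounded /bounded_op_gt0[M M_gt0 UM] UTA]]].
move=> [Y [Yh [S [f [g [fg gf fc gc]]]]]].
have [N N_gt0 gN] := bounded_op_gt0 (continuous_bounded_op gc).
pose J : {linear C0 -> Y} := @csub_val _ _ S \o (f \o (T \o A)).
apply: (@C0_not_embedded R k Y J (M * N) Yh); first exact: mulr_gt0.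
move=> u; rewrite -[u in leLHS]/(idfun u) UTA; apply: le_trans (UM _) _.
rewrite -mulrA ler_wpM2l ?(ltW M_gt0)// -[in leLHS](fg (T (A u))).
exact: gN.
Qed.

End splitting.

Theorem theorem1p2 (R : realType) (k : scalar_kind)
    (X : completeNormedModType (scalar_field R k))
    (T : {linear C0_omega1 R k -> X})
    (T_bounded : bounded_op T)
    (T_surj : forall x : X, exists f : C0_omega1 R k, T f = x) :
  let alternative_I :=
    exists Y : completeNormedModType (scalar_field R k),
      hilbert_generated Y /\ embeds X Y in
  let alternative_II :=
    factors_through (idfun : {linear C0_omega1 R k -> C0_omega1 R k}) T /\
    exists (Y : completeNormedModType (scalar_field R k)) (Z : closed_subspace Y),
      hilbert_generated Y /\
      isomorphic X (C0_omega1 R k * csub_type Z)%type in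
  (alternative_I \/ alternative_II) /\ ~ (alternative_I /\ alternative_II).
Proof.
move=> alternative_I alternative_II; split; last first.
  by move=> [I [II _]]; exact: not_both II I.
have [[b Tb]|unbounded] := pselect (exists b : omega1, forall a, (b < a)%O ->
    exists2 f, T f = 0 & f a != 0).
  left; exists X; split.
    exact: (quotient_hilbert_generated T_bounded T_surj Tb).
  by exists (full_csub X); exact: isomorphic_full_csub.
right; apply: quotient_split => // b; apply: contrapT => h; apply: unbounded.
exists b => a ba; apply: contrapT => h'; apply: h; exists a => // f Tf.
by apply/eqP; apply: contrapT => /negP fa; apply: h'; exists f.
Qed.
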